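(* Let $X$ be a diffeological space and $G$ a diffeological group, and let $\varrho:G\to\mathrm{Diff}(G)$, $\varrho(g)=L_g$, be the smooth action of $G$ on itself by left translations. Then diffeological fiber bundles with gauge group $G$ and fiber $G$ on $X$ (with respect to $\varrho$) are exactly the diffeological principal $G$-bundles on $X$; that is, every diffeological principal $G$-bundle $\pi:E\to X$ is a diffeological fiber bundle with gauge group $G$ and fiber $G$, and for every diffeological fiber bundle $\pi:E\to X$ with gauge group $G$ and fiber $G$ there is a natural smooth action of $G$ on $E$ making $\pi$ a diffeological principal $G$-bundle. As a result, there is a bijective correspondence between $\check H^1(X,G)$ and $\mathrm{Bund}_G(X,G)\cong\mathrm{Bund}_{Prin}(X,G)$, where $\mathrm{Bund}_{Prin}(X,G)$ is the set of isomorphism classes of diffeological principal $G$-bundles on $X$. In the case where $G$ is abelian, there is a bijective correspondence between the first diffeological Čech cohomology group $\check H^1(X,G)$ and $\mathrm{Bund}_{Prin}(X,G)$.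
   Context: Diffeology. A domain is an open subset of some $\mathbb{R}^n$; a diffeology on a set $X$ is a set of parametrizations (maps from domains to $X$), called plots, whose images cover $X$, closed under precomposition with smooth maps between domains and under suprema of compatible families (families of plots on $n$-domains agreeing on overlaps). Smooth maps are those sending plots to plots by composition. A covering generating family of $X$ is a set $\mathcal{C}$ of plots whose images cover $X$ and such that every plot is the supremum of a compatible family of parametrizations $P\circ F$ with $P\in\mathcal{C}$, $F$ smooth between domains. A morphism of plots $Q\xrightarrow{F}P$ is a smooth map $F:\mathrm{dom}(Q)\to\mathrm{dom}(P)$ with $P\circ F=Q$. A diffeological group is a group with a diffeology making multiplication and inversion smooth. $\mathrm{Diff}(T)$ is the group of diffeomorphisms of $T$ with the standard diffeology: $P:U\to\mathrm{Diff}(T)$ is a plot iff $(r,t)\mapsto P(r)(t)$ and $(r,t)\mapsto P(r)^{-1}(t)$ are smooth on $U\times T$. A smooth action of $G$ on $T$ is a smooth homomorphism $G\to\mathrm{Diff}(T)$. We write $\varrho g(r)(t)$ for $\varrho(g(r))(t)$. Principal bundles. Let $G$ act smoothly on $E$ and let $\pi:E\to X$ be a surjective smooth map. For a plot $P:U\to X$, $P^*E=\{(u,e)\in U\times E:P(u)=\pi(e)\}$ carries the action $g(u,e)=(u,ge)$, and $P^*\pi$ is its first projection. $\pi$ is a diffeological principal $G$-bundle if for every plot $P$ the pullback $P^*\pi$ is a locally trivial principal $G$-bundle, i.e. $\mathrm{dom}(P)$ has an open cover $\{U_i\}$ such that over each $U_i$ there is a $G$-equivariant diffeomorphism with $U_i\times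 G$ commuting with the projections to $U_i$, where $G$ acts on $U_i\times G$ by translations on the factor $G$ on the side opposite to $\varrho$ (i.e. by right translations, $k\cdot(u,h)=(u,hk^{-1})$). Two principal $G$-bundles $\pi:E\to X$, $\pi':E'\to X$ are isomorphic if there is a $G$-equivariant diffeomorphism $\phi:E\to E'$ with $\pi'\circ\phi=\pi$. Simplices. A $1$-simplex on $\mathcal{C}$ is a diagram $P_0\xleftarrow{F_1}Q\xrightarrow{F_0}P_1$ of morphisms of plots with $P_0,P_1\in\mathcal{C}$. A $2$-simplex on $\mathcal{C}$ consists of $P_0,P_1,P_2\in\mathcal{C}$, $1$-simplices $P_0\xleftarrow{F_{2,1}}Q_2\xrightarrow{F_{2,0}}P_1$, $P_0\xleftarrow{F_{1,2}}Q_1\xrightarrow{F_{1,0}}P_2$, $P_1\xleftarrow{F_{0,2}}Q_0\xrightarrow{F_{0,1}}P_2$, a plot $Q$ and morphisms $Q\xrightarrow{F_i}Q_i$ ($i=0,1,2$) with $F_{i,j}\circ F_i=F_{j,i}\circ F_j$. Bundles with gauge group. A diffeological fiber bundle with gauge group $G$ and typical fiber $T$ on $X$ (here $T=G$) is a smooth map $\pi:E\to X$ such that there is a covering generating family $\mathcal{C}$ of $X$ along with: (a) for every $P\in\mathcal{C}$ a smooth map $\psi_P:\mathrm{dom}(P)\times T\to E$ such that the square $\pi\circ\psi_P=P\circ\mathrm{Pr}_1$ is a pullback in the category of diffeological spaces; (b) for each $1$-simplex a smooth map $g_{P_0\xleftarrow{F_1}Q\xrightarrow{F_0}P_1}:\mathrm{dom}(Q)\to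 G$ with $\psi_{P_1}(F_0(r),t)=\psi_{P_0}\big(F_1(r),\varrho g_{P_0\xleftarrow{F_1}Q\xrightarrow{F_0}P_1}(r)(t)\big)$ for all $(r,t)\in\mathrm{dom}(Q)\times T$. A refinement of $\mathcal{C}=\{P_\alpha\}_{\alpha\in I}$ is a covering generating family $\mathcal{C}'=\{P'_\beta\}_{\beta\in J}$ with a map $\lambda:J\to I$ and morphisms $P'_\beta\xrightarrow{f_\beta}P_{\lambda(\beta)}$. An isomorphism between two such bundles $\pi:E\to X$, $\pi':E'\to X$ (with data $\mathcal{C},\psi,g$ and $\mathcal{C}',\psi',g'$) is a diffeomorphism $\Phi:E\to E'$ with $\pi'\circ\Phi=\pi$, together with a common refinement $\{R_\beta\}_{\beta\in J}$ of $\mathcal{C}$ and $\mathcal{C}'$ with refinement data $P_{\lambda(\beta)}\xleftarrow{f_\beta}R_\beta\xrightarrow{f'_\beta}P'_{\lambda'(\beta)}$, such that for each $\beta$ there is a smooth map $h_\beta:\mathrm{dom}(R_\beta)\to G$ with $\Phi\circ\psi_{P_{\lambda(\beta)}}(f_\beta(r),t)=\psi'_{P'_{\lambda'(\beta)}}(f'_\beta(r),\varrho h_\beta(r)(t))$ for all $(r,t)$. $\mathrm{Bund}_T(X,G)$ is the set of isomorphism classes. Čech cohomology. A diffeological Čech $1$-cocycle on $\mathcal{C}$ with values in $G$ assigns to each $1$-simplex on $\mathcal{C}$ a smooth map $g_{P_0\xleftarrow{F_1}Q\xrightarrow{F_0}P_1}:\mathrm{dom}(Q)\to G$ such that for every $2$-simplex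 on $\mathcal{C}$ and $r\in\mathrm{dom}(Q)$, $g_{P_0\xleftarrow{F_{2,1}}Q_2\xrightarrow{F_{2,0}}P_1}(F_2(r))\,g_{P_1\xleftarrow{F_{0,2}}Q_0\xrightarrow{F_{0,1}}P_2}(F_0(r))=g_{P_0\xleftarrow{F_{1,2}}Q_1\xrightarrow{F_{1,0}}P_2}(F_1(r))$. Cocycles $g,g'$ on $\mathcal{C}$ are equivalent if there are smooth maps $h_P:\mathrm{dom}(P)\to G$ ($P\in\mathcal{C}$) with $g'_{P_0\xleftarrow{F_1}Q\xrightarrow{F_0}P_1}(r)\,h_{P_1}(F_0(r))=h_{P_0}(F_1(r))\,g_{P_0\xleftarrow{F_1}Q\xrightarrow{F_0}P_1}(r)$ for every $1$-simplex and all $r$. $H^1(X,\mathcal{C},G)$ is the set of equivalence classes. A refinement induces a map $H^1(X,\mathcal{C},G)\to H^1(X,\mathcal{C}',G)$ by assigning to a $1$-simplex $P'_{\beta_0}\xleftarrow{F_1}Q\xrightarrow{F_0}P'_{\beta_1}$ the value of $g$ at $P_{\lambda(\beta_0)}\xleftarrow{f_{\beta_0}F_1}Q\xrightarrow{f_{\beta_1}F_0}P_{\lambda(\beta_1)}$; it does not depend on the particular refinement map. $\check H^1(X,G)=\varinjlim_{\mathcal{C}}H^1(X,\mathcal{C},G)$. When $G$ is abelian, the first diffeological Čech cohomology group $\check H^1(X,G)$ is the colimit over $\mathcal{C}$ of the degree $1$ cohomology groups of the complex $C^n=\prod_{n\text{-simplices}}\{\text{smooth maps }\mathrm{dom}(\text{nerve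 plot})\to G\}$, with coboundaries (written additively) $\delta^0(c)(P_0\xleftarrow{F_1}Q\xrightarrow{F_0}P_1)=F_0^*c(P_1)-F_1^*c(P_0)$ and $\delta^1(c)(P_0,P_1,P_2)=F_0^*c(P_1,P_2)-F_1^*c(P_0,P_2)+F_2^*c(P_0,P_1)$; $0$-simplices are elements of $\mathcal{C}$. *)

(* Defs.v *)
From Stdlib Require Import Relation_Operators.
From HB Require Import structures.
From mathcomp Require Import all_boot all_algebra.
From mathcomp Require Import boolp classical_sets functions reals topology normedtype landau derive.
Set Implicit Arguments.
Unset Strict Implicit.
Unset Printing Implicit Defensive.
Import GRing.Theory Num.Theory.
Import numFieldNormedType.Exports.
Local Open Scope classical_set_scope.
Local Open Scope ring_scope.

Section ContDiff.
Variable R : realType.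

Fixpoint cont_diff (W : normedModType R) (k n : nat) (U : set 'rV[R]_n)
    (f : 'rV[R]_n -> W) : Prop :=
  if k is k'.+1 then
    (forall x, U x -> differentiable f x) /\
    (forall i : 'I_n, cont_diff k' U ('D_(delta_mx 0 i) f))
  else forall x, U x -> {for x, continuous f}.

Lemma near_eq_differentiable (V W : normedModType R) (f g : V -> W) x :
  (\near x, f x = g x) -> differentiable f x -> differentiable g x.
Proof.
move=> fg df; have fgx : f x = g x by exact: nbhs_singleton fg.
have dfc : continuous ('d f x) by exact: diff_continuous.
have gE : g \o shift x = cst (g x) + 'd f x +o_ 0 id.
  apply/eqaddoP => e e0; have /eqaddoP/(_ e e0) := diff_locally df.
  have fg0 : \forall h \near (0 : V), f (h + x) = g (h + x).
    move: fg; rewrite (near_shift 0) /=; apply: filterS => h /=.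
    by rewrite subr0.
  move=> H; apply: filterS2 fg0 H => h fgh /=.
  have -> : (g \o shift x - (cst (g x) + 'd f x)) h = (f \o shift x - (cst (f x) + 'd f x)) h.
    by rewrite !fctE /= fgh fgx.
  by [].
by apply/diff_locallyP; rewrite (diff_unique dfc gE).
Qed.

Lemma cont_diff_eq (W : normedModType R) k n (U : set 'rV[R]_n) (f g : 'rV[R]_n -> W) :
  open U -> (forall x, U x -> f x = g x) -> cont_diff k U f -> cont_diff k U g.
Proof.
move=> Uo; elim: k f g => [|k IH] f g fg /=.
  move=> cf x Ux; have fgn : \near x, f x = g x.
    by near=> y; apply: fg; near: y; exact: open_nbhs_nbhs.
  rewrite /prop_for /continuous_at -(fg _ Ux).
  by apply: cvg_trans (cf x Ux); exact: (@near_eq_cvg _ _ (nbhs x) _ f g fgn).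
move=> [df Df]; split=> [x Ux|i].
  apply: near_eq_differentiable (df x Ux).
  by near=> y; apply: fg; near: y; exact: open_nbhs_nbhs.
apply: IH (Df i) => x Ux; apply: near_eq_derive.
by near=> y; apply: fg; near: y; exact: open_nbhs_nbhs.
Unshelve. all: by end_near. Qed.

Lemma cont_diff_pred (W : normedModType R) k n (U : set 'rV[R]_n) (f : 'rV[R]_n -> W) :
  cont_diff k.+1 U f -> cont_diff k U f.
Proof.
elim: k f => [|k IH] f [df Df]; first by move=> x Ux; exact/differentiable_continuous/df.
by split=> // i; apply: IH; exact: Df.
Qed.

Lemma cont_diff_local (W : normedModType R) k n I (V : I -> set 'rV[R]_n)
    (U : set 'rV[R]_n) (f : 'rV[R]_n -> W) :
  (forall x, U x -> exists i, V i x) -> (forall i, cont_diff k (V i) f) ->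
  cont_diff k U f.
Proof.
move=> UV; elim: k f => [|k IH] f Vf /=.
  by move=> x /UV [i Vx]; exact: Vf Vx.
split=> [x /UV [i Vx]|j]; first by have [+ _] := Vf i; exact.
by apply: IH => i; have [_] := Vf i; exact.
Qed.

Lemma cont_diff_cst (W : normedModType R) k n (U : set 'rV[R]_n) (a : W) :
  cont_diff k U (fun=> a).
Proof.
elim: k a => [|k IH] a /=; first by move=> x _; exact: cst_continuous.
split=> [x _|i]; first exact: differentiable_cst.
by rewrite (_ : 'D_ _ _ = fun=> 0) //; apply/funext => x; rewrite derive_cst.
Qed.

Lemma cont_diff_id k n (U : set 'rV[R]_n) : cont_diff k U (id : 'rV[R]_n -> _).
Proof.
case: k => [|k] /=; first by move=> x _; exact: cvg_id.
split=> [x _|i]; first exact: ex_diff.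
rewrite (_ : 'D_ _ _ = fun=> delta_mx 0 i); first exact: cont_diff_cst.
by apply/funext => x; rewrite derive_id.
Qed.

Lemma cont_diffD (W : normedModType R) k n (U : set 'rV[R]_n)
    (f g : 'rV[R]_n -> W) : open U ->
  cont_diff k U f -> cont_diff k U g -> cont_diff k U (f + g).
Proof.
move=> Uo; elim: k f g => [|k IH] f g /=.
  by move=> cf cg x Ux; apply: continuousD; [exact: cf|exact: cg].
move=> [df Df] [dg Dg]; split=> [x Ux|i].
  by apply: differentiableD; [exact: df|exact: dg].
apply: cont_diff_eq (IH _ _ (Df i) (Dg i)) => // x Ux.
by rewrite deriveD //; apply: diff_derivable; [exact: df|exact: dg].
Qed.

Lemma cont_diff_sum (W : normedModType R) k n p (U : set 'rV[R]_n)
    (f : 'I_p -> 'rV[R]_n -> W) : open U ->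
  (forall i, cont_diff k U (f i)) -> cont_diff k U (\sum_i f i).
Proof.
move=> Uo cf; elim/big_ind: _ => //; first exact: cont_diff_cst.
by move=> g h; exact: cont_diffD.
Qed.

Lemma cont_diff_lin (V W : normedModType R) k n (U : set 'rV[R]_n)
    (f : 'rV[R]_n -> V) (A : {linear V -> W}) : continuous A -> open U ->
  cont_diff k U f -> cont_diff k U (A \o f).
Proof.
move=> Ac Uo; elim: k f => [|k IH] f /=.
  by move=> cf x Ux; apply: continuous_comp; [exact: cf|exact: Ac].
have dA y : differentiable A y by exact: linear_differentiable.
move=> [df Df]; split=> [x Ux|i].
  by apply: differentiable_comp; [exact: df|exact: dA].
apply: cont_diff_eq (IH _ (Df i)) => // x Ux.
rewrite deriveE; last by apply: differentiable_comp; [exact: df|exact: dA].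
rewrite diff_comp //=; last exact: df.
by rewrite diff_lin // -deriveE //; exact: df.
Qed.

Lemma cont_diffM k n (U : set 'rV[R]_n) (f g : 'rV[R]_n -> R) : open U ->
  cont_diff k U f -> cont_diff k U g -> cont_diff k U (f * g).
Proof.
move=> Uo; elim: k f g => [|k IH] f g /=.
  by move=> cf cg x Ux; apply: continuousM; [exact: cf|exact: cg].
move=> /[dup] /cont_diff_pred cf [df Df] /[dup] /cont_diff_pred cg [dg Dg].
split=> [x Ux|i]; first by apply: differentiableM; [exact: df|exact: dg].
apply: (cont_diff_eq (f := f * 'D_(delta_mx 0 i) g + g * 'D_(delta_mx 0 i) f)) => //.
  move=> x Ux; rewrite deriveM //; apply: diff_derivable; [exact: df|exact: dg].
by apply: cont_diffD => //; apply: IH.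
Qed.

Definition coord_lin n (j : 'I_n) (v : 'rV[R]_n) : R := v 0 j.
Lemma coord_lin_is_linear n j : linear (@coord_lin n j).
Proof. by move=> a u v; rewrite /coord_lin !mxE. Qed.
HB.instance Definition _ n j :=
  GRing.isLinear.Build R 'rV[R]_n R _ (@coord_lin n j) (@coord_lin_is_linear n j).

Definition line_lin n (j : 'I_n) (a : R) : 'rV[R]_n := a *: delta_mx 0 j.
Lemma line_lin_is_linear n j : linear (@line_lin n j).
Proof. by move=> a u v; rewrite /line_lin scalerDl scalerA. Qed.
HB.instance Definition _ n j :=
  GRing.isLinear.Build R R 'rV[R]_n _ (@line_lin n j) (@line_lin_is_linear n j).

Lemma cont_diff_coord k n m (U : set 'rV[R]_n) (f : 'rV[R]_n -> 'rV[R]_m) :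
  open U ->
  cont_diff k U f <-> forall j, cont_diff k U (fun x => f x 0 j : R).
Proof.
move=> Uo; split=> [cf j|cf].
  apply: (@cont_diff_lin _ _ k n U f (@coord_lin m j)) => //.
  exact: coord_continuous.
have -> : f = \sum_j (@line_lin m j \o (fun x => f x 0 j)).
  apply/funext => x; rewrite fct_sumE [LHS]row_sum_delta.
  by apply: eq_bigr.
apply: cont_diff_sum => // j; apply: cont_diff_lin => //.
exact: scalel_continuous.
Qed.

Lemma cont_diff_comp1 k n m (U : set 'rV[R]_n) (V : set 'rV[R]_m)
    (f : 'rV[R]_n -> 'rV[R]_m) (g : 'rV[R]_m -> R) :
  open U -> open V -> (forall x, U x -> V (f x)) ->
  cont_diff k U f -> cont_diff k V g -> cont_diff k U (g \o f).
Proof.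
move=> Uo Vo UV cf cg.
elim: k f g UV cf cg => [|k IH] f g UV /=.
  by move=> cf cg x Ux; apply: continuous_comp; [exact: cf|exact/cg/UV].
move=> /[dup] /cont_diff_pred cf [df Df] [dg Dg].
have dgf x : U x -> differentiable (g \o f) x.
  by move=> Ux; apply: differentiable_comp; [exact: df|exact/dg/UV].
split=> [//|i].
pose h := \sum_(j < m) ((fun x => 'D_(delta_mx 0 i) f x 0 j) *
   ('D_(delta_mx 0 j) g \o f)).
apply: (cont_diff_eq (f := h)) => // [x Ux|].
  rewrite deriveE; last exact: dgf.
  rewrite diff_comp; [|exact: df|exact/dg/UV].
  rewrite /= -(deriveE _ (df x Ux)) [in RHS](row_sum_delta ('D_(delta_mx 0 i) f x)).
  rewrite linear_sum /h fct_sumE; apply: eq_bigr => j _.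
  by rewrite linearZ /= -deriveE //; exact/dg/UV.
apply: cont_diff_sum => // j; apply: cont_diffM => //.
  by move: (Df i) => /(cont_diff_coord _ _ Uo); exact.
by apply: IH.
Qed.

Lemma cont_diff_comp k n m p (U : set 'rV[R]_n) (V : set 'rV[R]_m)
    (f : 'rV[R]_n -> 'rV[R]_m) (g : 'rV[R]_m -> 'rV[R]_p) :
  open U -> open V -> (forall x, U x -> V (f x)) ->
  cont_diff k U f -> cont_diff k V g -> cont_diff k U (g \o f).
Proof.
move=> Uo Vo UV cf /(cont_diff_coord _ _ Vo) cg; apply/cont_diff_coord => // l.
exact: (cont_diff_comp1 Uo Vo UV cf (cg l)).
Qed.
End ContDiff.

Record domain (R : realType) (n : nat) := Domain {
  dset : set 'rV[R]_n;
  dset_open : open dset }.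

Definition pts (R : realType) n (U : domain R n) : Type := set_type (dset U).
Coercion pts : domain >-> Sortclass.
Definition pval (R : realType) n (U : domain R n) (u : U) : 'rV[R]_n := val u.

Section DomainSmooth.
Variable R : realType.

(* Since V is open, the iterated partial derivatives on V of the total map f
   depend only on F. *)
Definition domain_smooth n m (V : domain R m) (U : domain R n)
    (F : V -> U) : Prop :=
  exists f : 'rV[R]_m -> 'rV[R]_n,
    (forall k, cont_diff k (dset V) f) /\ (forall v : V, pval (F v) = f (pval v)).

Lemma pvalP n (U : domain R n) (u : U) : dset U (pval u).
Proof. exact: set_mem (valP u). Qed.

Lemma pval_inj n (U : domain R n) : injective (@pval R n U).
Proof. exact: val_inj. Qed.

Definition to_pt n (U : domain R n) x (Ux : dset U x) : U :=
  exist _ x (mem_set Ux).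

Lemma domain_smooth_id n (U : domain R n) : domain_smooth (@id U).
Proof. by exists id; split=> // k; exact: cont_diff_id. Qed.

Lemma domain_smooth_cst n m (V : domain R m) (U : domain R n) (u : U) :
  domain_smooth (fun _ : V => u).
Proof. by exists (fun=> pval u); split=> // k; exact: cont_diff_cst. Qed.

Lemma domain_smooth_comp n m p (W : domain R p) (V : domain R m)
    (U : domain R n) (F : V -> U) (F' : W -> V) :
  domain_smooth F -> domain_smooth F' -> domain_smooth (F \o F').
Proof.
move=> [f [cf fE]] [f' [cf' f'E]]; exists (f \o f'); split=> [k|w]; last first.
  by rewrite /= fE f'E.
apply: (cont_diff_comp (V := dset V)) => //; [exact: dset_open|exact: dset_open|].
by move=> x Wx; have := f'E (to_pt Wx); rewrite {2}/pval /= => <-; exact: pvalP.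
Qed.

(* P is the supremum of the family Q: its domain is the union of those of the
   Q i, and it extends each of them. The existence of such a P says that Q is a
   compatible family. *)
Definition is_supremum (X : Type) n (I : Type) (V : I -> domain R n)
    (Q : forall i, V i -> X) (U : domain R n) (P : U -> X) : Prop :=
  (forall x, dset U x <-> exists i, dset (V i) x) /\
  (forall i (v : V i) (u : U), pval u = pval v -> P u = Q i v).

Lemma domain_smooth_sup n m I (V : I -> domain R n) (W : domain R m)
    (Q : forall i, V i -> W) (U : domain R n) (P : U -> W) :
  (forall i, domain_smooth (Q i)) -> is_supremum Q P -> domain_smooth P.
Proof.
move=> Qs [UV PQ].
pose f x := if pselect (dset U x) is left Ux then pval (P (to_pt Ux)) else 0.
have fE (u : U) : pval (P u) = f (pval u).
  rewrite /f; case: pselect => [Ux|/(_ (pvalP u))//].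
  by congr (pval (P _)); exact: val_inj.
exists f; split=> // k; apply: (cont_diff_local (V := fun i => dset (V i))).
  by move=> x /UV.
move=> i; have [g [cg gE]] := Qs i.
apply: (cont_diff_eq (f := g)) => // [|x Vx]; first exact: dset_open.
have Ux : dset U x by apply/UV; exists i.
rewrite -[x in RHS]/(pval (to_pt Ux)) -fE -[x in LHS]/(pval (to_pt Vx)) -gE.
by rewrite (PQ i (to_pt Vx)).
Qed.

Lemma domain_smooth_open n m (V : domain R m) (U W : domain R n) (F : V -> U) :
  domain_smooth F -> open [set x | exists2 v : V, pval v = x & dset W (pval (F v))].
Proof.
move=> [f [cf fE]]; rewrite openE => _ [v <- Wv] /=.
have cfv : {for pval v, continuous f} by exact: (cf 0%N _ (pvalP v)).
have nV : nbhs (pval v) (dset V).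
  by apply: open_nbhs_nbhs; split; [exact: dset_open|exact: pvalP].
have nW : nbhs (pval v) (f @^-1` dset W).
  apply: cfv; apply: open_nbhs_nbhs; split; first exact: dset_open.
  by rewrite -fE.
apply: filterS2 nV nW => x Vx Wx /=.
by exists (to_pt Vx) => //; rewrite fE.
Qed.

Definition preim_domain n m (V : domain R m) (U : domain R n) (F : V -> U)
    (Fs : domain_smooth F) (W : domain R n) : domain R m :=
  Domain (@domain_smooth_open n m V U W F Fs).

Section Preim.
Variables (n m : nat) (V : domain R m) (U : domain R n) (F : V -> U).
Variables (Fs : domain_smooth F) (W : domain R n).

Lemma preim_sub (w : preim_domain Fs W) : dset V (pval w).
Proof. by have [v <- _] := pvalP w; exact: pvalP. Qed.

Definition preim_incl (w : preim_domain Fs W) : V := to_pt (preim_sub w).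

Lemma preim_mem (w : preim_domain Fs W) : dset W (pval (F (preim_incl w))).
Proof.
have [v vw Wv] := pvalP w.
by rewrite (_ : preim_incl w = v) //; apply: pval_inj; rewrite vw.
Qed.

Definition preim_fun (w : preim_domain Fs W) : W := to_pt (preim_mem w).

Lemma preim_incl_smooth : domain_smooth preim_incl.
Proof. by exists id; split=> // k; exact: cont_diff_id. Qed.

Lemma preim_fun_smooth : domain_smooth preim_fun.
Proof.
have [f [cf fE]] := domain_smooth_comp Fs preim_incl_smooth.
by exists f; split=> // w; rewrite -fE.
Qed.

End Preim.

End DomainSmooth.

HB.mixin Record isDiffeological (R : realType) (X : Type) := {
  is_plot : forall n (U : domain R n), (U -> X) -> Prop;
  plot_cover : forall x : X, exists n (U : domain R n) (P : U -> X) (u : U),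
    is_plot _ U P /\ P u = x;
  plot_comp : forall n m (U : domain R n) (V : domain R m)
      (P : U -> X) (F : V -> U),
    is_plot _ U P -> domain_smooth F -> is_plot _ V (P \o F);
  plot_sup : forall n (I : Type) (V : I -> domain R n)
      (Q : forall i, V i -> X) (U : domain R n) (P : U -> X),
    (forall i, is_plot _ (V i) (Q i)) -> is_supremum Q P -> is_plot _ U P }.

#[short(type="diffType")]
HB.structure Definition Diffeological (R : realType) :=
  {X of isDiffeological R X}.

Arguments is_plot {R s n U} P.
Arguments plot_comp {R s n m U V P F}.
Arguments plot_sup {R s n I V Q U P}.

Definition smooth (R : realType) (X Y : diffType R) (f : X -> Y) : Prop :=
  forall n (U : domain R n) (P : U -> X), is_plot P -> is_plot (f \o P).

Section Spaces.
Variable R : realType.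
Implicit Types X Y Z T : diffType R.

Lemma smooth_comp X Y Z (f : X -> Y) (g : Y -> Z) :
  smooth f -> smooth g -> smooth (g \o f).
Proof. by move=> fs gs n U P Pp; exact/gs/fs. Qed.

Lemma plot_cst X n (U : domain R n) (x : X) : is_plot (fun _ : U => x).
Proof.
have [m [V [P [v [Pp <-]]]]] := plot_cover x.
exact: (plot_comp Pp (domain_smooth_cst U v)).
Qed.

Definition domain_plot n (D : domain R n) m (U : domain R m) (P : U -> D) :=
  domain_smooth P.

Fact domain_plot_cover n (D : domain R n) (x : D) :
  exists m (U : domain R m) (P : U -> D) (u : U), domain_plot P /\ P u = x.
Proof. by exists n, D, id, x; split=> //; exact: domain_smooth_id. Qed.

Fact domain_plot_comp n (D : domain R n) m p (U : domain R m) (V : domain R p)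
    (P : U -> D) (F : V -> U) :
  domain_plot P -> domain_smooth F -> domain_plot (P \o F).
Proof. exact: domain_smooth_comp. Qed.

Fact domain_plot_sup n (D : domain R n) m I (V : I -> domain R m)
    (Q : forall i, V i -> D) (U : domain R m) (P : U -> D) :
  (forall i, domain_plot (Q i)) -> is_supremum Q P -> domain_plot P.
Proof. exact: domain_smooth_sup. Qed.

HB.instance Definition _ n (D : domain R n) :=
  isDiffeological.Build R (pts D) (@domain_plot_cover n D)
    (@domain_plot_comp n D) (@domain_plot_sup n D).

Definition prod_plot X Y n (U : domain R n) (P : U -> X * Y) :=
  is_plot (fst \o P) /\ is_plot (snd \o P).

Fact prod_plot_cover X Y (x : X * Y) :
  exists n (U : domain R n) (P : U -> X * Y) (u : U), prod_plot P /\ P u = x.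
Proof.
pose U := @Domain R 0 setT openT.
exists 0%N, U, (fun=> x), (@to_pt R 0 U 0 I).
by split=> //; split; exact: plot_cst.
Qed.

Fact prod_plot_comp X Y n m (U : domain R n) (V : domain R m)
    (P : U -> X * Y) (F : V -> U) :
  prod_plot P -> domain_smooth F -> prod_plot (P \o F).
Proof.
by move=> [P1 P2] Fs; split; [exact: (plot_comp P1)|exact: (plot_comp P2)].
Qed.

Fact prod_plot_sup X Y n I (V : I -> domain R n) (Q : forall i, V i -> X * Y)
    (U : domain R n) (P : U -> X * Y) :
  (forall i, prod_plot (Q i)) -> is_supremum Q P -> prod_plot P.
Proof.
move=> Qp [UV PQ]; split.
- apply: (plot_sup (Q := fun i => fst \o Q i)) => [i|]; first by case: (Qp i).
  by split=> // i v u uv /=; rewrite (PQ i v).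
- apply: (plot_sup (Q := fun i => snd \o Q i)) => [i|]; first by case: (Qp i).
  by split=> // i v u uv /=; rewrite (PQ i v).
Qed.

HB.instance Definition _ X Y := isDiffeological.Build R (X * Y)%type
  (@prod_plot_cover X Y) (@prod_plot_comp X Y) (@prod_plot_sup X Y).

Definition subset_space X (A : set X) : Type := set_type A.
Definition subset_val X (A : set X) (x : subset_space A) : X := val x.

Definition subset_plot X (A : set X) n (U : domain R n)
  (P : U -> subset_space A) := is_plot (@subset_val X A \o P).

Fact subset_plot_cover X (A : set X) (x : subset_space A) :
  exists n (U : domain R n) (P : U -> subset_space A) (u : U),
    subset_plot P /\ P u = x.
Proof.
pose U := @Domain R 0 setT openT.
exists 0%N, U, (fun=> x), (@to_pt R 0 U 0 I).
by split=> //; exact: plot_cst.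
Qed.

Fact subset_plot_comp X (A : set X) n m (U : domain R n) (V : domain R m)
    (P : U -> subset_space A) (F : V -> U) :
  subset_plot P -> domain_smooth F -> subset_plot (P \o F).
Proof. exact: plot_comp. Qed.

Fact subset_plot_sup X (A : set X) n I (V : I -> domain R n)
    (Q : forall i, V i -> subset_space A) (U : domain R n)
    (P : U -> subset_space A) :
  (forall i, subset_plot (Q i)) -> is_supremum Q P -> subset_plot P.
Proof.
move=> Qp [UV PQ]; apply: (plot_sup Qp); split=> // i v u uv /=.
by rewrite (PQ i v).
Qed.

HB.instance Definition _ X (A : set X) :=
  isDiffeological.Build R (subset_space A) (@subset_plot_cover X A)
    (@subset_plot_comp X A) (@subset_plot_sup X A).

End Spaces.

Record diffeo (R : realType) (X Y : diffType R) := Diffeo {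
  dfun :> X -> Y;
  dinv : Y -> X;
  dfun_smooth : smooth dfun;
  dinv_smooth : smooth dinv;
  dfunK : cancel dfun dinv;
  dinvK : cancel dinv dfun }.

Section DiffSpace.
Variables (R : realType) (T : diffType R).

Definition Diff : Type := diffeo T T.

Definition Diff_plot n (U : domain R n) (P : U -> Diff) : Prop :=
  smooth (fun rt : U * T => P rt.1 rt.2) /\
  smooth (fun rt : U * T => dinv (P rt.1) rt.2).

Fact Diff_plot_cover (phi : Diff) :
  exists n (U : domain R n) (P : U -> Diff) (u : U), Diff_plot P /\ P u = phi.
Proof.
pose U := @Domain R 0 setT openT.
exists 0%N, U, (fun=> phi), (@to_pt R 0 U 0 I).
split=> //; split=> n V P [_ P2]; first exact: (dfun_smooth phi P2).
exact: (dinv_smooth phi P2).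
Qed.

Fact Diff_plot_comp n m (U : domain R n) (V : domain R m)
    (P : U -> Diff) (F : V -> U) :
  Diff_plot P -> domain_smooth F -> Diff_plot (P \o F).
Proof.
move=> [P1 P2] Fs; split=> p W Q [Q1 Q2].
- apply: (P1 _ _ (fun w => (F (Q w).1, (Q w).2))); split=> //.
  exact: (domain_smooth_comp Fs Q1).
- apply: (P2 _ _ (fun w => (F (Q w).1, (Q w).2))); split=> //.
  exact: (domain_smooth_comp Fs Q1).
Qed.

Fact Diff_plot_sup n I (V : I -> domain R n) (Q : forall i, V i -> Diff)
    (U : domain R n) (P : U -> Diff) :
  (forall i, Diff_plot (Q i)) -> is_supremum Q P -> Diff_plot P.
Proof.
move=> Qp [UV PQ].
have cov m (W : domain R m) (a : W -> U) (as_ : domain_smooth a) x :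
    dset W x <-> exists i, dset (preim_domain as_ (V i)) x.
  split=> [Wx|[i [w <- _]]]; last exact: pvalP.
  have /UV [i Vi] := pvalP (a (to_pt Wx)).
  by exists i; exists (to_pt Wx).
have restr m (W : domain R m) (a : W -> U) (as_ : domain_smooth a) i
    (v : preim_domain as_ (V i)) (u : W) :
    pval u = pval v -> P (a u) = Q i (preim_fun v) /\ u = preim_incl v.
  move=> uv; have -> : u = preim_incl v by exact: pval_inj.
  by split=> //; apply: PQ.
split=> m W S [S1 S2].
- apply: (plot_sup (V := fun i => preim_domain S1 (V i))
    (Q := fun i w => Q i (preim_fun w) (S (preim_incl w)).2)) => [i|].
    have [+ _] := Qp i => /(_ _ _ (fun w : preim_domain S1 (V i) =>
      (preim_fun w, (S (preim_incl w)).2))); apply; split.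
      exact: preim_fun_smooth.
    exact: (plot_comp S2 (@preim_incl_smooth _ _ _ _ _ _ S1 (V i))).
  split=> [x|i v u uv /=]; first exact: cov.
  by have [-> ->] := restr _ _ _ S1 i v u uv.
- apply: (plot_sup (V := fun i => preim_domain S1 (V i))
    (Q := fun i w => dinv (Q i (preim_fun w)) (S (preim_incl w)).2)) => [i|].
    have [_] := Qp i => /(_ _ _ (fun w : preim_domain S1 (V i) =>
      (preim_fun w, (S (preim_incl w)).2))); apply; split.
      exact: preim_fun_smooth.
    exact: (plot_comp S2 (@preim_incl_smooth _ _ _ _ _ _ S1 (V i))).
  split=> [x|i v u uv /=]; first exact: cov.
  by have [-> ->] := restr _ _ _ S1 i v u uv.
Qed.

HB.instance Definition _ := isDiffeological.Build R Diff
  Diff_plot_cover Diff_plot_comp Diff_plot_sup.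

End DiffSpace.

HB.mixin Record Diffeological_isDiffGroup (R : realType) (G : Type)
    of Diffeological R G & Group G := {
  mulg_smooth : smooth (fun gh : (G * G)%type => (gh.1 * gh.2)%g);
  invg_smooth : smooth (fun g : G => (g^-1)%g) }.

#[short(type="diffGroupType")]
HB.structure Definition DiffGroup (R : realType) :=
  {G of Diffeological R G & Group G & Diffeological_isDiffGroup R G}.

Record smooth_action (R : realType) (G : diffGroupType R) (T : diffType R) :=
  SmoothAction {
    act :> G -> Diff T;
    act_smooth : smooth act;
    actM : forall (g h : G) (t : T), act (g * h)%g t = act g (act h t) }.

Section GroupMaps.
Variables (R : realType) (G : diffGroupType R).

Lemma smooth_mulg (X : diffType R) (f f' : X -> G) :
  smooth f -> smooth f' -> smooth (fun x => f x * f' x)%g.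
Proof.
move=> fs fs' n U P Pp.
apply: (mulg_smooth n U (fun u => (f (P u), f' (P u)))).
by split; [exact: fs|exact: fs'].
Qed.

Lemma smooth_invg (X : diffType R) (f : X -> G) :
  smooth f -> smooth (fun x => (f x)^-1)%g.
Proof. by move=> fs; exact: (smooth_comp fs invg_smooth). Qed.

Lemma smooth_fst (X Y : diffType R) : smooth (@fst X Y).
Proof. by move=> n U P []. Qed.

Lemma smooth_snd (X Y : diffType R) : smooth (@snd X Y).
Proof. by move=> n U P []. Qed.

Lemma smooth_cst (X Y : diffType R) (y : Y) : smooth (fun _ : X => y).
Proof. by move=> n U P _; exact: plot_cst. Qed.

Fact left_mulg_smooth (g : G) : smooth (fun h : G => g * h)%g.
Proof. by apply: smooth_mulg => //; exact: smooth_cst. Qed.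

Definition left_mulg (g : G) : Diff G :=
  Diffeo (left_mulg_smooth g) (left_mulg_smooth g^-1%g) (mulKg g) (mulVKg g).

Fact left_mulg_act_smooth : smooth left_mulg.
Proof.
move=> n U P Pp.
have P1 : smooth (fun rt : (U * G)%type => P rt.1).
  by move=> m V Q [Q1 _]; exact: (plot_comp Pp Q1).
split; apply: smooth_mulg; [exact: P1|exact: smooth_snd| |exact: smooth_snd].
exact: smooth_invg.
Qed.

Fact left_mulgM (g h t : G) :
  left_mulg (g * h)%g t = left_mulg g (left_mulg h t).
Proof. by rewrite /= mulgA. Qed.

Definition left_translation : smooth_action G G :=
  SmoothAction left_mulg_act_smooth left_mulgM.

End GroupMaps.

Record plot (R : realType) (X : diffType R) := Plot {
  pdim : nat;
  pdom : domain R pdim;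
  pfun :> pdom -> X;
  pfunP : is_plot pfun }.

Record plot_mor (R : realType) (X : diffType R) (Q P : plot X) := PlotMor {
  mfun :> pdom Q -> pdom P;
  mfun_smooth : domain_smooth mfun;
  mfunE : forall r, P (mfun r) = Q r }.

Definition covering_generating (R : realType) (X : diffType R)
    (C : set (plot X)) : Prop :=
  (forall x : X, exists2 P : plot X, C P & exists u, P u = x) /\
  (forall P : plot X, exists (I : Type) (V : I -> domain R (pdim P))
     (Q : forall i, V i -> X),
     is_supremum Q P /\
     forall i, exists P' : plot X, C P' /\
       exists2 F : V i -> pdom P', domain_smooth F &
         forall v, Q i v = P' (F v)).

Record cgf (R : realType) (X : diffType R) := Cgf {
  cset : set (plot X);
  csetP : covering_generating cset }.

Definition members (R : realType) (X : diffType R) (C : cgf X) : Type :=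
  set_type (cset C).
Coercion members : cgf >-> Sortclass.
Definition mplot (R : realType) (X : diffType R) (C : cgf X)
  (P : members C) : plot X := val P.
Coercion mplot : members >-> plot.

(* A covering generating family is a set of plots, hence indexed by itself;
   C' is a refinement of C. *)
Record refinement (R : realType) (X : diffType R) (C C' : cgf X) :=
  Refinement {
    rmap : C' -> C;
    rmor : forall P : C', plot_mor P (rmap P) }.

Section PlotMorphisms.
Variables (R : realType) (X : diffType R).

Fact plot_mor_compE (P1 P2 P3 : plot X) (F : plot_mor P2 P3)
  (F' : plot_mor P1 P2) r : P3 ((F \o F') r) = P1 r.
Proof. by rewrite /= !mfunE. Qed.

Definition plot_mor_comp (P1 P2 P3 : plot X) (F : plot_mor P2 P3)
    (F' : plot_mor P1 P2) : plot_mor P1 P3 :=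
  PlotMor (domain_smooth_comp (mfun_smooth F) (mfun_smooth F'))
    (plot_mor_compE F F').

Lemma plot_mor_smooth (P Q : plot X) (F : plot_mor Q P) : smooth F.
Proof.
by move=> n U S Ss; exact: (domain_smooth_comp (mfun_smooth F) Ss).
Qed.

End PlotMorphisms.

(* s1P0 <-s1F1- s1Q -s1F0-> s1P1 *)
Record simplex1 (R : realType) (X : diffType R) (C : cgf X) := Simplex1 {
  s1P0 : C;
  s1P1 : C;
  s1Q : plot X;
  s1F1 : plot_mor s1Q s1P0;
  s1F0 : plot_mor s1Q s1P1 }.

Record simplex2 (R : realType) (X : diffType R) (C : cgf X) := Simplex2 {
  s2P0 : C;
  s2P1 : C;
  s2P2 : C;
  s2Q2 : plot X;
  s2Q1 : plot X;
  s2Q0 : plot X;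
  s2F21 : plot_mor s2Q2 s2P0;
  s2F20 : plot_mor s2Q2 s2P1;
  s2F12 : plot_mor s2Q1 s2P0;
  s2F10 : plot_mor s2Q1 s2P2;
  s2F02 : plot_mor s2Q0 s2P1;
  s2F01 : plot_mor s2Q0 s2P2;
  s2Q : plot X;
  s2F0 : plot_mor s2Q s2Q0;
  s2F1 : plot_mor s2Q s2Q1;
  s2F2 : plot_mor s2Q s2Q2;
  s2E01 : forall r, s2F01 (s2F0 r) = s2F10 (s2F1 r);
  s2E02 : forall r, s2F02 (s2F0 r) = s2F20 (s2F2 r);
  s2E12 : forall r, s2F12 (s2F1 r) = s2F21 (s2F2 r) }.

Section Faces.
Variables (R : realType) (X : diffType R) (C : cgf X) (s : simplex2 C).

Definition face2 : simplex1 C := Simplex1 (s2F21 s) (s2F20 s).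
Definition face1 : simplex1 C := Simplex1 (s2F12 s) (s2F10 s).
Definition face0 : simplex1 C := Simplex1 (s2F02 s) (s2F01 s).

End Faces.

Definition simplex1_ref (R : realType) (X : diffType R) (C C' : cgf X)
    (rho : refinement C C') (s : simplex1 C') : simplex1 C :=
  Simplex1 (plot_mor_comp (rmor rho (s1P0 s)) (s1F1 s))
    (plot_mor_comp (rmor rho (s1P1 s)) (s1F0 s)).

Section Simplex2Ref.
Variables (R : realType) (X : diffType R) (C C' : cgf X).
Variables (rho : refinement C C') (s : simplex2 C').
Let comp (P : C') Q (F : plot_mor Q P) := plot_mor_comp (rmor rho P) F.

Fact simplex2_refE01 r :
  comp (s2F01 s) (s2F0 s r) = comp (s2F10 s) (s2F1 s r).
Proof. by rewrite /= s2E01. Qed.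
Fact simplex2_refE02 r :
  comp (s2F02 s) (s2F0 s r) = comp (s2F20 s) (s2F2 s r).
Proof. by rewrite /= s2E02. Qed.
Fact simplex2_refE12 r :
  comp (s2F12 s) (s2F1 s r) = comp (s2F21 s) (s2F2 s r).
Proof. by rewrite /= s2E12. Qed.

Definition simplex2_ref : simplex2 C :=
  Simplex2 simplex2_refE01 simplex2_refE02 simplex2_refE12.

End Simplex2Ref.

(* The set of classes of a relation. This is not built from set_type, whose
   universe is bounded by that of the carriers of diffeological spaces, while
   bundles live one level higher. *)
Definition quotient (T : Type) (r : T -> T -> Prop) : Type :=
  {A : T -> Prop | exists x, A = r x}.

Definition class_of (T : Type) (r : T -> T -> Prop) (x : T) : quotient r :=
  exist _ (r x) (ex_intro _ x erefl).

(* The colimit of sets H(C) along refinements: the disjoint union of the H(C)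
   modulo the equivalence relation generated by a ~ a' whenever a' is the image
   of a under the map induced by a refinement. The map induced by rho is given
   by its graph res rho. *)
Section Colimit.
Variables (R : realType) (X : diffType R) (H : cgf X -> Type).
Variable res : forall C C' : cgf X, refinement C C' -> H C -> H C' -> Prop.

Definition colimit_step (a b : {C : cgf X & H C}) : Prop :=
  exists rho : refinement (tag a) (tag b), res rho (tagged a) (tagged b).

Definition colimit : Type :=
  quotient (clos_refl_sym_trans {C : cgf X & H C} colimit_step).

Definition to_colimit (C : cgf X) (a : H C) : colimit :=
  class_of _ (existT H C a).

End Colimit.

Record cochain0 (R : realType) (X : diffType R) (C : cgf X)
    (G : diffGroupType R) := Cochain0 {
  cochain0_fun :> forall P : C, pdom P -> G;
  cochain0_smooth : forall P, smooth (@cochain0_fun P) }.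

Arguments cochain0_fun {R X C G} c P _ : rename.
Arguments cochain0_smooth {R X C G} c P : rename.

Record cochain1 (R : realType) (X : diffType R) (C : cgf X)
    (G : diffGroupType R) := Cochain1 {
  cochain1_fun :> forall s : simplex1 C, pdom (s1Q s) -> G;
  cochain1_smooth : forall s, smooth (@cochain1_fun s) }.

Arguments cochain1_fun {R X C G} c s _ : rename.
Arguments cochain1_smooth {R X C G} c s : rename.

Record cochain2 (R : realType) (X : diffType R) (C : cgf X)
    (G : diffGroupType R) := Cochain2 {
  cochain2_fun :> forall s : simplex2 C, pdom (s2Q s) -> G;
  cochain2_smooth : forall s, smooth (@cochain2_fun s) }.

Arguments cochain2_fun {R X C G} c s _ : rename.
Arguments cochain2_smooth {R X C G} c s : rename.

Definition cochain1_ref (R : realType) (X : diffType R) (G : diffGroupType R)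
    (C C' : cgf X) (rho : refinement C C') (c : cochain1 C G) :
    cochain1 C' G :=
  @Cochain1 R X C' G (fun s => c (simplex1_ref rho s))
    (fun s => cochain1_smooth c (simplex1_ref rho s)).

Definition cochain0_ref (R : realType) (X : diffType R) (G : diffGroupType R)
    (C C' : cgf X) (rho : refinement C C') (h : cochain0 C G) :
    cochain0 C' G :=
  @Cochain0 R X C' G (fun P => h (rmap rho P) \o rmor rho P)
    (fun P => smooth_comp (@plot_mor_smooth _ _ _ _ (rmor rho P))
      (cochain0_smooth h (rmap rho P))).

Section NonAbelian.
Variables (R : realType) (X : diffType R) (G : diffGroupType R).

Definition is_cocycle (C : cgf X) (g : cochain1 C G) : Prop :=
  forall (s : simplex2 C) (r : pdom (s2Q s)),
    (g (face2 s) (s2F2 s r) * g (face0 s) (s2F0 s r))%g =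
    g (face1 s) (s2F1 s r).

Record cocycle (C : cgf X) := Cocycle {
  cocycle_fun :> cochain1 C G;
  cocycleP : is_cocycle cocycle_fun }.

Arguments cocycleP {C} g s r : rename.

Definition cocycle_equiv (C : cgf X) (g g' : cocycle C) : Prop :=
  exists h : cochain0 C G, forall (s : simplex1 C) (r : pdom (s1Q s)),
    (g' s r * h (s1P1 s) (s1F0 s r))%g = (h (s1P0 s) (s1F1 s r) * g s r)%g.

Definition H1_on (C : cgf X) : Type := quotient (@cocycle_equiv C).

Fact cocycle_refP (C C' : cgf X) (rho : refinement C C') (g : cocycle C) :
  is_cocycle (cochain1_ref rho g).
Proof. by move=> s r; exact: (cocycleP g (simplex2_ref rho s) r). Qed.

Definition cocycle_ref (C C' : cgf X) (rho : refinement C C')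
  (g : cocycle C) : cocycle C' := Cocycle (cocycle_refP rho g).

Lemma cocycle_ref_equiv (C C' : cgf X) (rho : refinement C C')
    (g g' : cocycle C) :
  cocycle_equiv g g' -> cocycle_equiv (cocycle_ref rho g) (cocycle_ref rho g').
Proof.
by move=> [h hE]; exists (cochain0_ref rho h) => s r; exact: (hE (simplex1_ref rho s)).
Qed.

Definition H1_res (C C' : cgf X) (rho : refinement C C')
    (a : H1_on C) (a' : H1_on C') : Prop :=
  exists g : cocycle C,
    a = class_of _ g /\ a' = class_of _ (cocycle_ref rho g).

Definition cech_H1 : Type := colimit H1_res.

Definition cech_class (C : cgf X) (g : cocycle C) : cech_H1 :=
  to_colimit H1_res (class_of (@cocycle_equiv C) g).

End NonAbelian.

(* The degree 1 cohomology of the Cech complex, in multiplicative notation;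
   it is meant for a commutative G. As refinements make the covering generating
   families a directed system, the colimit of the underlying sets is the
   underlying set of the colimit of the groups ker delta1 / im delta0. *)
Section Abelian.
Variables (R : realType) (X : diffType R) (G : diffGroupType R).

Fact delta0_smooth (C : cgf X) (c : cochain0 C G) (s : simplex1 C) :
  smooth (fun r : pdom (s1Q s) =>
    c (s1P1 s) (s1F0 s r) * (c (s1P0 s) (s1F1 s r))^-1)%g.
Proof.
apply: smooth_mulg; last apply: smooth_invg.
  exact: (smooth_comp (@plot_mor_smooth _ _ _ _ _) (cochain0_smooth c _)).
exact: (smooth_comp (@plot_mor_smooth _ _ _ _ _) (cochain0_smooth c _)).
Qed.

Definition delta0 (C : cgf X) (c : cochain0 C G) : cochain1 C G :=
  Cochain1 (delta0_smooth c).

Fact delta1_smooth (C : cgf X) (c : cochain1 C G) (s : simplex2 C) :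
  smooth (fun r : pdom (s2Q s) =>
    c (face0 s) (s2F0 s r) * (c (face1 s) (s2F1 s r))^-1 *
    c (face2 s) (s2F2 s r))%g.
Proof.
apply: smooth_mulg; first apply: smooth_mulg; last 1 first.
- exact: (smooth_comp (@plot_mor_smooth _ _ _ _ (s2F2 s))
    (cochain1_smooth c (face2 s))).
- exact: (smooth_comp (@plot_mor_smooth _ _ _ _ (s2F0 s))
    (cochain1_smooth c (face0 s))).
- apply: smooth_invg; exact: (smooth_comp (@plot_mor_smooth _ _ _ _ (s2F1 s))
    (cochain1_smooth c (face1 s))).
Qed.

Definition delta1 (C : cgf X) (c : cochain1 C G) : cochain2 C G :=
  Cochain2 (delta1_smooth c).

Record ab_cocycle (C : cgf X) := AbCocycle {
  ab_cocycle_fun :> cochain1 C G;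
  ab_cocycleP : forall s r, delta1 ab_cocycle_fun s r = 1%g }.

Arguments ab_cocycleP {C} c s r : rename.

Definition cohomologous (C : cgf X) (c c' : ab_cocycle C) : Prop :=
  exists b : cochain0 C G, forall (s : simplex1 C) (r : pdom (s1Q s)),
    (c' s r * (c s r)^-1)%g = delta0 b s r.

Definition ab_H1_on (C : cgf X) : Type := quotient (@cohomologous C).

Fact ab_cocycle_refP (C C' : cgf X) (rho : refinement C C')
  (c : ab_cocycle C) s r : delta1 (cochain1_ref rho c) s r = 1%g.
Proof. exact: (ab_cocycleP c (simplex2_ref rho s) r). Qed.

Definition ab_cocycle_ref (C C' : cgf X) (rho : refinement C C')
  (c : ab_cocycle C) : ab_cocycle C' := AbCocycle (ab_cocycle_refP rho c).

Lemma ab_cocycle_ref_cohomologous (C C' : cgf X) (rho : refinement C C')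
    (c c' : ab_cocycle C) :
  cohomologous c c' ->
  cohomologous (ab_cocycle_ref rho c) (ab_cocycle_ref rho c').
Proof.
by move=> [b bE]; exists (cochain0_ref rho b) => s r; exact: (bE (simplex1_ref rho s)).
Qed.

Definition ab_H1_res (C C' : cgf X) (rho : refinement C C')
    (a : ab_H1_on C) (a' : ab_H1_on C') : Prop :=
  exists c : ab_cocycle C,
    a = class_of _ c /\ a' = class_of _ (ab_cocycle_ref rho c).

Definition ab_cech_H1 : Type := colimit ab_H1_res.

Definition ab_cech_class (C : cgf X) (c : ab_cocycle C) : ab_cech_H1 :=
  to_colimit ab_H1_res (class_of (@cohomologous C) c).

End Abelian.

Definition is_pullback (R : realType) (A B C D : diffType R)
    (p : A -> B) (q : A -> C) (f : B -> D) (g : C -> D) : Prop :=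
  (forall a, f (p a) = g (q a)) /\
  (forall (Z : diffType R) (b : Z -> B) (c : Z -> C), smooth b -> smooth c ->
     (forall z, f (b z) = g (c z)) ->
     exists! u : Z -> A,
       [/\ smooth u, forall z, p (u z) = b z & forall z, q (u z) = c z]).

Record gauge_data (R : realType) (X : diffType R) (G : diffGroupType R)
    (T : diffType R) (rho : smooth_action G T) (E : diffType R)
    (proj : E -> X) := GaugeData {
  gfam : cgf X;
  chart : forall P : gfam, (pdom P * T)%type -> E;
  chart_smooth : forall P, smooth (@chart P);
  chart_pullback : forall P : gfam,
    is_pullback (fst : (pdom P * T)%type -> pdom P) (@chart P) P proj;
  gauge : forall s : simplex1 gfam, pdom (s1Q s) -> G;
  gauge_smooth : forall s, smooth (@gauge s);
  gaugeP : forall (s : simplex1 gfam) (r : pdom (s1Q s)) (t : T),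
    @chart (s1P1 s) (s1F0 s r, t) =
    @chart (s1P0 s) (s1F1 s r, rho (@gauge s r) t) }.

Arguments chart {R X G T rho E proj} g P _ : rename.
Arguments chart_smooth {R X G T rho E proj} g P : rename.
Arguments gauge {R X G T rho E proj} g s _ : rename.
Arguments gauge_smooth {R X G T rho E proj} g s : rename.

Record gauge_bundle (R : realType) (X : diffType R) (G : diffGroupType R)
    (T : diffType R) (rho : smooth_action G T) := GaugeBundle {
  gtot : diffType R;
  gproj : gtot -> X;
  gproj_smooth : smooth gproj;
  gdata :> gauge_data rho gproj }.

Arguments gproj {R X G T rho} g _ : rename.

Section GaugeBundles.
Variables (R : realType) (X : diffType R) (G : diffGroupType R).
Variables (T : diffType R) (rho : smooth_action G T).

Definition gauge_bundle_iso (B B' : gauge_bundle X rho) : Prop :=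
  exists (Phi : diffeo (gtot B) (gtot B')) (C : cgf X)
         (rf : refinement (gfam B) C) (rf' : refinement (gfam B') C),
    (forall e, gproj B' (Phi e) = gproj B e) /\
    forall P : C, exists2 h : pdom P -> G, smooth h &
      forall (r : pdom P) (t : T),
        Phi (chart B (rmap rf P) (rmor rf P r, t)) =
        chart B' (rmap rf' P) (rmor rf' P r, rho (h r) t).

Definition Bund : Type := quotient gauge_bundle_iso.

Definition bund_class (B : gauge_bundle X rho) : Bund :=
  class_of gauge_bundle_iso B.

End GaugeBundles.

Section PullbackBundle.
Variables (R : realType) (X E : diffType R) (proj : E -> X) (P : plot X).

Definition pull_set : set (pdom P * E)%type :=
  [set ue | P ue.1 = proj ue.2].
Definition pull_space : Type := subset_space pull_set.

Definition pull_proj (y : pull_space) : pdom P := (subset_val y).1.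

Variables (G : diffGroupType R) (alpha : smooth_action G E).
Hypothesis alpha_proj : forall (g : G) (e : E), proj (alpha g e) = proj e.

Fact pull_actP (g : G) (y : pull_space) :
  pull_set ((subset_val y).1, alpha g (subset_val y).2).
Proof. by rewrite /pull_set /= alpha_proj; exact: set_mem (valP y). Qed.

Definition pull_act (g : G) (y : pull_space) : pull_space :=
  exist (fun z => z \in pull_set) _ (mem_set (pull_actP g y)).

End PullbackBundle.

(* The trivializations are given by their inverses chi, defined on V_i * G,
   where G acts by k . (u, h) = (u, h k^-1). *)
Definition locally_trivial_principal (R : realType) (G : diffGroupType R)
    (Y : diffType R) n (U : domain R n) (p : Y -> U) (a : G -> Y -> Y) : Prop :=
  exists (I : Type) (V : I -> domain R n),
    (forall x, dset U x <-> exists i, dset (V i) x) /\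
    forall i, exists chi : diffeo (V i * G)%type
        (subset_space [set y : Y | dset (V i) (pval (p y))]),
      (forall v h, pval (p (subset_val (chi (v, h)))) = pval v) /\
      (forall k v h,
         subset_val (chi (v, h * k^-1)%g) = a k (subset_val (chi (v, h)))).

Record is_principal (R : realType) (X : diffType R) (G : diffGroupType R)
    (E : diffType R) (alpha : smooth_action G E) (proj : E -> X) : Prop := {
  principal_smooth : smooth proj;
  principal_surj : forall x, exists e, proj e = x;
  principal_inv : forall (g : G) (e : E), proj (alpha g e) = proj e;
  principal_triv : forall P : plot X,
    locally_trivial_principal (@pull_proj R X E proj P)
      (@pull_act R X E proj P G alpha principal_inv) }.

Record principal_bundle (R : realType) (X : diffType R)
    (G : diffGroupType R) := PrincipalBundle {
  ptot : diffType R;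
  pact : smooth_action G ptot;
  pproj : ptot -> X;
  pprojP : is_principal pact pproj }.

Arguments pproj {R X G} p _ : rename.

Section PrincipalBundles.
Variables (R : realType) (X : diffType R) (G : diffGroupType R).

Definition principal_bundle_iso (B B' : principal_bundle X G) : Prop :=
  exists phi : diffeo (ptot B) (ptot B'),
    (forall (g : G) e, phi (pact B g e) = pact B' g (phi e)) /\
    (forall e, pproj B' (phi e) = pproj B e).

Definition Bund_Prin : Type := quotient principal_bundle_iso.

Definition bund_prin_class (B : principal_bundle X G) : Bund_Prin :=
  class_of principal_bundle_iso B.

End PrincipalBundles.

(* In the charts, alpha is the action of G on itself by right translations; as
   the charts are jointly surjective, this determines alpha. *)
Definition natural_action (R : realType) (X : diffType R)
    (G : diffGroupType R) (E : diffType R) (proj : E -> X)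
    (D : gauge_data (left_translation G) proj) (alpha : smooth_action G E)
    : Prop :=
  forall (P : gfam D) (r : pdom P) (h k : G),
    alpha k (chart D P (r, h)) = chart D P (r, h * k^-1)%g.

(* Main.v *)
From Stdlib Require Import Relation_Operators RelationClasses.
From HB Require Import structures.
From mathcomp Require Import all_boot all_algebra.
From mathcomp Require Import boolp classical_sets reals topology.
Require Import Defs.
Set Implicit Arguments.
Unset Strict Implicit.
Unset Printing Implicit Defensive.

(** Charts are the common language of the two kinds of bundles. A chart over a
plot [P] of [X] is a map [psi : U * G -> E] forming a pullback square with [P]
and the projection ([trivializing]); it amounts to smooth coordinates in [G] on
the points of [E] over [P].

The gauge transformations of a bundle with fiber [G] are left translations.
They commute with right translations, so right translations in the charts
agree on overlaps and define an action of [G] on the whole of [E]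
([natural_action_exists]). A plot of [X] factors locally through the covering
generating family, and pulling a chart back along the factorization gives an
equivariant local trivialization ([natural_action_principal]). Conversely, the
plots over which a principal bundle has a global equivariant chart form a
covering generating family, because local triviality holds over every plot; an
equivariant map between trivial bundles is a left translation on each fiber,
and this provides the gauge transformations ([principal_gauge_data]).

The same argument applies to isomorphisms: on a common refinement, an
equivariant diffeomorphism over [X] is given by left translations, and
conversely. Hence two gauge bundles are isomorphic exactly when their natural
principal bundles are ([gauge_iso_principal]), which gives the bijection
between the two sets of isomorphism classes and shows on the way that
isomorphism of gauge bundles is an equivalence relation.

For the classification by cocycles, comparing charts through an isomorphism
shows that isomorphic bundles have equivalent gauge cocycles on some common
refinement ([gauge_iso_equiv]), and maps defined chart by chart show the
converse ([equiv_gauge_iso]). What remains is to realize a cocycle as the gauge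
of a bundle. The value of a cocycle [g] at a point of a 1-simplex depends only
on the two points of the charts, because a degenerate 2-simplex compares the
simplex with its restriction to a point ([cocycle_trans]). So [g] is a family
of transition elements, and a point of the bundle over [x] is a system of
coordinates, one for each chart and each point of that chart over [x], related
by these transition elements ([total]). The bijections out of the colimits then
follow from [colimit_bij], in the same way for general and for abelian
coefficients: in a commutative group the two notions of cocycle coincide, and
equivalence becomes cohomology after inverting the 0-cochain. *)

Local Open Scope classical_set_scope.
Local Open Scope group_scope.

(** * Quotients and colimits *)

Lemma inj_surj_bij (A B : Type) (f : A -> B) :
  injective f -> (forall b, exists a, f a = b) -> bijective f.
Proof. by move=> fI /choice [g gK]; exists g => // a; apply: fI; rewrite gK. Qed.

Lemma quotient_eq (T : Type) (r : T -> T -> Prop) (A B : quotient r) :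
  sval A = sval B -> A = B.
Proof.
case: A B => A Ar [B Br] /= AB; subst B.
by congr exist; exact: Prop_irrelevance.
Qed.

Lemma class_of_surj (T : Type) (r : T -> T -> Prop) (A : quotient r) :
  exists x, A = class_of r x.
Proof. by have [x Ax] := svalP A; exists x; exact: quotient_eq. Qed.

Lemma class_of_eq (T : Type) (r : T -> T -> Prop) (x y : T) :
  Equivalence r -> class_of r x = class_of r y <-> r x y.
Proof.
move=> [rr rs rt]; split=> [/(congr1 (@sval _ _)) /= ->|rxy]; first exact: rr.
by apply: quotient_eq; apply/funext => z; apply/propext; split; apply: rt => //; exact: rs.
Qed.

(** The classes of [r] are the fibers of [f], since the hypothesis makes [r] the
kernel of [f]. *)
Lemma quotient_bij (T Y : Type) (r : T -> T -> Prop) (f : T -> Y) :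
  (forall x y, f x = f y <-> r x y) -> (forall y, exists x, f x = y) ->
  exists F : quotient r -> Y, bijective F /\ forall x, F (class_of r x) = f x.
Proof.
move=> fr fS.
have rE : Equivalence r.
  by split=> [x|x y|x y z]; rewrite -!fr // => -> ->.
have [rep repE] := choice (@class_of_surj T r).
have FE x : f (rep (class_of r x)) = f x.
  by apply/fr/(class_of_eq _ _ rE); rewrite -repE.
exists (f \o rep); split=> //; apply: inj_surj_bij => [A B /= AB|y].
  by rewrite (repE A) (repE B); apply/class_of_eq => //; exact/fr.
by have [x <-] := fS y; exists (class_of r x); rewrite /= FE.
Qed.

Section ColimitBij.
Variables (R : realType) (X : diffType R) (Z : cgf X -> Type).
Variables (eqv : forall C, Z C -> Z C -> Prop).
Variable (ref : forall C C' : cgf X, refinement C C' -> Z C -> Z C').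
Variables (Y : Type) (F : forall C, Z C -> Y).
Arguments eqv {C} _ _.
Arguments F {C} _.

(** The common form of [H1_res] and [ab_H1_res], both of which are instances up
to conversion. *)
Definition class_res (C C' : cgf X) (rho : refinement C C')
    (a : quotient (@eqv C)) (a' : quotient (@eqv C')) : Prop :=
  exists g, a = class_of _ g /\ a' = class_of _ (ref rho g).

(** The quotients on the stages and the colimit are treated at once. An
invariant [F] of cocycles descends to the colimit as soon as it does not see
equivalence and refinement; it is injective there when equal invariants force
equivalence on a common refinement, since both cocycles have the class of their
restrictions. *)
Lemma colimit_bij :
  (forall C, Equivalence (@eqv C)) ->
  (forall C (g g' : Z C), eqv g g' -> F g = F g') ->
  (forall C C' (rho : refinement C C') g, F (ref rho g) = F g) ->
  (forall C C' (g : Z C) (g' : Z C'), F g = F g' ->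
     exists (D : cgf X) (rho : refinement C D) (rho' : refinement C' D),
       eqv (ref rho g) (ref rho' g')) ->
  (forall y, exists C (g : Z C), F g = y) ->
  exists f : colimit class_res -> Y, bijective f /\
    forall C (g : Z C), f (to_colimit class_res (class_of _ g)) = F g.
Proof.
move=> eqvE Feqv Fref FI FS.
have repr (a : {C : cgf X & quotient (@eqv C)}) :
    exists g : Z (tag a), tagged a = class_of _ g.
  exact: class_of_surj.
pose f a := F (sval (cid (repr a))).
have fE C (g : Z C) : f (existT _ C (class_of _ g)) = F g.
  rewrite /f; case: cid => g' /= gg'; apply/esym/Feqv.
  exact/(class_of_eq _ _ (eqvE C)).
have step_ref C C' (rho : refinement C C') g :
    colimit_step class_res (existT _ C (class_of _ g))
      (existT _ C' (class_of _ (ref rho g))).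
  by exists rho; exists g.
have [||h [hbij hE]] := @quotient_bij _ _ (clos_refl_sym_trans _ (colimit_step class_res)) f.
- move=> a b; split=> [|]; last first.
    elim=> {a b} [[C a] [C' b] [rho [g /= [-> ->]]]|//|a b _ -> //|a b c _ -> _ -> //].
    by rewrite !fE Fref.
  case: a b => [C a] [C' b].
  have [g /= ->] := repr (existT _ C a); have [g' /= ->] := repr (existT _ C' b).
  rewrite !fE => /FI [D [rho [rho' gg']]].
  apply: rst_trans (rst_step _ _ _ _ (step_ref _ _ rho g)) _.
  apply/rst_sym; have /class_of_eq -> // := gg'.
  exact: rst_step.
- by move=> y; have [C [g <-]] := FS y; exists (existT _ C (class_of _ g)).
by exists h; split=> // C g; rewrite /to_colimit hE fE.
Qed.

End ColimitBij.

(** * Local properties of parametrizations *)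

Section Local.
Variable R : realType.

Definition inclusion n (V U : domain R n) (j : V -> U) : Prop :=
  forall v, pval (j v) = pval v.

(** The subdomains are presented by their inclusions [j], so that restriction of
a parametrization is composition with [j]. *)
Definition locally n (U : domain R n)
    (Phi : forall V : domain R n, (V -> U) -> Prop) : Prop :=
  forall u : U, exists (V : domain R n) (j : V -> U),
    [/\ inclusion j, exists v, j v = u & Phi V j].

Lemma inclusion_smooth n (V U : domain R n) (j : V -> U) :
  inclusion j -> domain_smooth j.
Proof. by move=> jE; exists id; split=> // k; exact: cont_diff_id. Qed.

Lemma locally_impl n (U : domain R n) (Phi Psi : forall V : domain R n, (V -> U) -> Prop) :
  (forall V j, inclusion j -> Phi V j -> Psi V j) -> locally Phi -> locally Psi.
Proof.
by move=> PP Pl u; have [V [j [ji ju /(PP _ _ ji) Pj]]] := Pl u; exists V, j.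
Qed.

Lemma locally_cover n (U : domain R n) (Phi : forall V : domain R n, (V -> U) -> Prop) :
  locally Phi ->
  exists (V : U -> domain R n) (j : forall u, V u -> U),
    [/\ forall x, dset U x <-> exists u, dset (V u) x,
        forall u, inclusion (j u) & forall u, Phi (V u) (j u)].
Proof.
move=> Pl; have Pl' u : exists Vj : {V : domain R n & V -> U},
    [/\ inclusion (tagged Vj), exists v, tagged Vj v = u & Phi _ (tagged Vj)].
  by have [V [j Vj]] := Pl u; exists (existT _ V j).
have [Vj VjP] := choice Pl'; exists (fun u => tag (Vj u)), (fun u => tagged (Vj u)).
split=> [x|u|u]; try by have [] := VjP u.
split=> [Ux|[u Vx]].
  have [ji [v vx] _] := VjP (to_pt Ux); exists (to_pt Ux).
  by rewrite -[x]/(pval (to_pt Ux)) -{2}vx ji; exact: pvalP.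
by have [ji _ _] := VjP u; rewrite -[x]/(pval (to_pt Vx)) -ji; exact: pvalP.
Qed.

Lemma locally_sup (X : Type) n (U : domain R n) (P : U -> X)
    (Phi : forall V : domain R n, (V -> U) -> Prop) :
  locally Phi ->
  exists (V : U -> domain R n) (j : forall u, V u -> U),
    is_supremum (fun u => P \o j u) P /\ forall u, Phi (V u) (j u).
Proof.
move=> /locally_cover [V [j [Vc ji Pj]]]; exists V, j; split=> //.
split=> // u v w wv /=; congr P; apply: pval_inj; by rewrite ji.
Qed.

Lemma sup_locally (X : Type) n (U : domain R n) (P : U -> X) (I : Type)
    (V : I -> domain R n) (Q : forall i, V i -> X) :
  is_supremum Q P ->
  locally (fun W (j : W -> U) =>
    exists i (k : W -> V i), inclusion k /\ forall w, P (j w) = Q i (k w)).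
Proof.
move=> [Vc PQ] u; have /Vc [i Vu] := pvalP u.
have VU v : dset U (pval (v : V i)) by apply/Vc; exists i; exact: pvalP.
exists (V i), (fun v => to_pt (VU v)); split=> //.
  by exists (to_pt Vu); exact: pval_inj.
by exists i, id; split=> // v; exact: PQ.
Qed.

Lemma locally_comp n m (U : domain R n) (W : domain R m) (F : W -> U)
    (Phi : forall V : domain R n, (V -> U) -> Prop) :
  domain_smooth F -> locally Phi ->
  locally (fun W' (k : W' -> W) => exists (V : domain R n) (j : V -> U) (F' : W' -> V),
    [/\ Phi V j, inclusion j, domain_smooth F' & forall w, F (k w) = j (F' w)]).
Proof.
move=> Fs Pl w; have [V [j [ji [v jv] Pj]]] := Pl (F w).
have wV : dset (preim_domain Fs V) (pval w).
  by exists w => //; rewrite -jv ji; exact: pvalP.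
exists (preim_domain Fs V), (@preim_incl _ _ _ _ _ _ Fs V); split=> //.
  by exists (to_pt wV); exact: pval_inj.
exists V, j, (@preim_fun _ _ _ _ _ _ Fs V); split=> //.
  exact: preim_fun_smooth.
by move=> w'; apply: pval_inj; rewrite ji.
Qed.

(** The sheaf property of plots. *)
Lemma plot_local (X : diffType R) n (U : domain R n) (P : U -> X) :
  locally (fun V (j : V -> U) => is_plot (P \o j)) -> is_plot P.
Proof. by move=> /(locally_sup P) [V [j [Psup Pj]]]; exact: plot_sup Psup. Qed.

Lemma cgf_local (X : diffType R) (C : cgf X) n (U : domain R n) (P : U -> X) :
  is_plot P ->
  locally (fun V (j : V -> U) => exists (P' : C) (F : V -> pdom P'),
    domain_smooth F /\ forall v, P (j v) = P' (F v)).
Proof.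
move=> Pp; have [_ /(_ (Plot Pp)) [I [V [Q [Psup Qc]]]]] := csetP C.
apply: locally_impl (sup_locally Psup) => W j _ [i [k [ki PQ]]].
have [P' [CP' [F Fs QF]]] := Qc i.
exists (exist _ P' (mem_set CP')), (F \o k); split=> [|w].
  by apply: domain_smooth_comp Fs _; exact: inclusion_smooth.
by rewrite -QF -PQ.
Qed.

Lemma cgf_cover (X : diffType R) (C : cgf X) (x : X) :
  exists (P : C) (u : pdom P), P u = x.
Proof.
have [/(_ x) [P CP [u Pu]] _] := csetP C.
by exists (exist _ P (mem_set CP)), u.
Qed.

(** Covering of the points comes for free: every point lies on a plot, and this
plot factors through a member near the given parameter. *)
Lemma cgf_intro (X : diffType R) (K : set (plot X)) :
  (forall (P : plot X), locally (fun V (j : V -> pdom P) =>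
     exists P' : plot X, K P' /\ exists2 F : V -> pdom P', domain_smooth F &
       forall v, P (j v) = P' (F v))) ->
  covering_generating K.
Proof.
move=> Kl; split=> [x|P]; last first.
  have [V [j [Psup Kj]]] := locally_sup P (Kl P).
  by exists (pdom P), V, (fun u => P \o j u).
have [n [U [P [u [Pp Pu]]]]] := plot_cover x.
have [V [j [_ [v jv] [P' [KP' [F Fs PF]]]]]] := Kl (Plot Pp) u.
by exists P' => //; exists (F v); rewrite -PF /= jv.
Qed.

End Local.

(** * Charts of a bundle *)

Lemma smooth_pair (R : realType) (X Y Z : diffType R) (f : X -> Y) (g : X -> Z) :
  smooth f -> smooth g -> smooth (fun x => (f x, g x)).
Proof. by move=> fs gs n U P Pp; split; [exact: fs|exact: gs]. Qed.

Lemma smooth_id (R : realType) (X : diffType R) : smooth (@id X).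
Proof. by []. Qed.

Lemma smooth_domain (R : realType) n m (V : domain R m) (U : domain R n)
    (F : V -> U) : domain_smooth F -> smooth F.
Proof. by move=> Fs k W P Ps; exact: (domain_smooth_comp Fs Ps). Qed.

Lemma smooth_plot (R : realType) (X : diffType R) n (U : domain R n)
    (P : U -> X) : is_plot P -> smooth P.
Proof. by move=> Pp k W F Fs; exact: (plot_comp Pp Fs). Qed.

Lemma plot_smooth (R : realType) (X : diffType R) n (U : domain R n)
    (P : U -> X) : smooth P -> is_plot P.
Proof. by move=> /(_ _ _ _ (domain_smooth_id U)). Qed.

(** The space of real dimension 0: its maps are points, and the pullback
property tested on it describes the points of the fibers. *)
Definition pt_domain (R : realType) : domain R 0 := @Domain R 0 setT openT.

Definition pt0 (R : realType) : pt_domain R := @to_pt R 0 (pt_domain R) 0%R I.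

Section Trivializing.
Variables (R : realType) (X E T : diffType R) (proj : E -> X).

Definition trivializing n (U : domain R n) (P : U -> X)
    (psi : (U * T)%type -> E) : Prop :=
  smooth psi /\ is_pullback (fst : (U * T)%type -> U) psi P proj.

Section Theory.
Variables (n : nat) (U : domain R n) (P : U -> X) (psi : (U * T)%type -> E).
Hypothesis psiP : trivializing P psi.

Lemma triv_smooth : smooth psi.
Proof. by have [] := psiP. Qed.

Lemma triv_proj x : proj (psi x) = P x.1.
Proof. by have [_ []] := psiP. Qed.

Lemma triv_coord (Z : diffType R) (b : Z -> U) (c : Z -> E) :
  smooth b -> smooth c -> (forall z, P (b z) = proj (c z)) ->
  exists2 h : Z -> T, smooth h & forall z, psi (b z, h z) = c z.
Proof.
move=> bs cs bc; have [_ [_ /(_ _ _ _ bs cs bc)]] := psiP.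
move=> [u [[us ub uc] _]]; exists (snd \o u).
  exact: (smooth_comp us (@smooth_snd _ _ _)).
by move=> z; rewrite -ub -uc /=; case: (u z).
Qed.

Lemma triv_inj r h h' : psi (r, h) = psi (r, h') -> h = h'.
Proof.
move=> hh'; have [_ [_ pull]] := psiP.
have cs (Y Y' : diffType R) (y : Y) : smooth (fun _ : Y' => y).
  exact: smooth_cst.
have [|u [_ uu]] := pull (pt_domain R) (fun=> r) (fun=> psi (r, h)) (cs _ _ _) (cs _ _ _).
  by move=> _; rewrite triv_proj.
have u1 : u = fun=> (r, h) by apply: uu; split=> [|_|_]; [exact: cs| |].
have u2 : u = fun=> (r, h') by apply: uu; split=> [|_|_]; [exact: cs| |].
by have := congr1 (@^~ (pt0 R)) u1; rewrite u2 => -[].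
Qed.

Lemma triv_surj r e : P r = proj e -> exists h, psi (r, h) = e.
Proof.
move=> re.
have [|h _ /(_ (pt0 R)) hE] := triv_coord (Z := pt_domain R) (b := fun=> r) (c := fun=> e)
  (smooth_cst _) (smooth_cst _); first by [].
by exists (h (pt0 R)).
Qed.

End Theory.

Lemma triv_intro n (U : domain R n) (P : U -> X) (psi : (U * T)%type -> E) :
  smooth psi -> (forall x, proj (psi x) = P x.1) ->
  (forall r h h', psi (r, h) = psi (r, h') -> h = h') ->
  (forall (Z : diffType R) (b : Z -> U) (c : Z -> E), smooth b -> smooth c ->
     (forall z, P (b z) = proj (c z)) ->
     exists2 h : Z -> T, smooth h & forall z, psi (b z, h z) = c z) ->
  trivializing P psi.
Proof.
move=> psis psip psiI psiC; split=> //; split=> // Z b c bs cs bc.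
have [h hs hE] := psiC Z b c bs cs bc; exists (fun z => (b z, h z)); split.
  by split=> //; exact: smooth_pair.
move=> u [us ub uc]; apply/funext => z; rewrite [RHS]surjective_pairing ub.
congr pair; apply: (psiI (b z)); rewrite hE -uc -ub.
by rewrite -surjective_pairing.
Qed.

Lemma triv_comp n m (U : domain R n) (V : domain R m) (P : U -> X)
    (psi : (U * T)%type -> E) (F : V -> U) :
  domain_smooth F -> trivializing P psi ->
  trivializing (P \o F) (fun x : (V * T)%type => psi (F x.1, x.2)).
Proof.
move=> Fs psiP; apply: triv_intro => [|x|r h h'|Z b c bs cs bc].
- apply: (smooth_comp _ (triv_smooth psiP)).
  apply: smooth_pair (@smooth_snd _ _ _).
  exact: (smooth_comp (@smooth_fst _ _ _) (smooth_domain Fs)).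
- exact: triv_proj psiP _.
- by move=> hh; exact: (triv_inj psiP hh).
- exact: (triv_coord psiP (smooth_comp bs (smooth_domain Fs)) cs bc).
Qed.

Definition atlas (C : cgf X) (psi : forall P : C, (pdom P * T)%type -> E) :=
  forall P : C, trivializing P (psi P).

Section Atlas.
Variables (C : cgf X) (psi : forall P : C, (pdom P * T)%type -> E).
Arguments psi P _ : clear implicits.
Hypothesis psiP : atlas psi.

Lemma atlas_cover e : exists (P : C) r h, psi P (r, h) = e.
Proof.
have [P [r Pr]] := cgf_cover C (proj e).
by have [h he] := triv_surj (psiP P) Pr; exists P, r, h.
Qed.

(** A plot of [E] has, locally, smooth coordinates in one chart, so smoothness
can be tested in the charts. The parameter space [K] serves for actions, where
joint smoothness is required. *)
Lemma atlas_smooth (K Y : diffType R) (f : (K * E)%type -> Y) :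
  smooth proj ->
  (forall P : C, smooth (fun x : (K * (pdom P * T))%type => f (x.1, psi P x.2))) ->
  smooth f.
Proof.
move=> projs fs n U S [S1 S2]; apply: plot_local.
apply: locally_impl (cgf_local C (projs _ _ _ S2)) => V j ji [P [F [Fs SF]]].
have Sj : is_plot (snd \o S \o j) by exact: plot_comp S2 (inclusion_smooth ji).
have [h hs hE] := triv_coord (psiP P) (smooth_domain Fs) (smooth_plot Sj)
  (fun v => esym (SF v)).
have -> : f \o S \o j = fun v => f ((S (j v)).1, psi P (F v, h v)).
  by apply/funext => v; rewrite hE /= -surjective_pairing.
apply: (fs P _ _ (fun v => ((S (j v)).1, (F v, h v)))); split.
  exact: (plot_comp S1 (inclusion_smooth ji)).
by split; [exact: Fs|exact: plot_smooth].
Qed.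

Lemma atlas_glue (Y : Type) (phi : forall P : C, (pdom P * T)%type -> Y) :
  (forall (P P' : C) x x', psi P x = psi P' x' -> phi P x = phi P' x') ->
  exists f : E -> Y, forall P x, f (psi P x) = phi P x.
Proof.
move=> phiE; have /choice [f fE] : forall e, exists y, forall P x,
    psi P x = e -> phi P x = y.
  move=> e; have [P [r [h <-]]] := atlas_cover e.
  by exists (phi P (r, h)) => P' x'; exact: phiE.
by exists f => P x; rewrite (fE _ _ _ erefl).
Qed.

End Atlas.

Lemma atlas_ref (C D : cgf X) (psi : forall P : C, (pdom P * T)%type -> E)
    (rho : refinement C D) :
  atlas psi -> atlas (fun (P : D) x => psi (rmap rho P) (rmor rho P x.1, x.2)).
Proof.
move=> psiP P; have := triv_comp (mfun_smooth (rmor rho P)) (psiP (rmap rho P)).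
by congr (trivializing _ _); apply/funext => r; exact: mfunE.
Qed.

End Trivializing.

Arguments triv_inj {R X E T proj n U P psi} _ {r h h'} _.

(** * The bundle of a cocycle *)

Section PointSimplex.
Variables (R : realType) (X : diffType R).

(** Two points of members of [C] over the same point [x] of [X] span a 1-simplex
whose middle plot is the point [x]. *)
Definition pt_plot (x : X) : plot X := Plot (plot_cst (pt_domain R) x).

Definition pt_mor (P : plot X) (r : pdom P) (x : X) (e : P r = x) :
    plot_mor (pt_plot x) P :=
  @PlotMor R X (pt_plot x) P (fun=> r) (domain_smooth_cst _ r) (fun=> e).

Definition pt_simplex (C : cgf X) (x : X) (P0 P1 : C) (r0 : pdom P0)
    (r1 : pdom P1) (e0 : P0 r0 = x) (e1 : P1 r1 = x) : simplex1 C :=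
  Simplex1 (pt_mor e0) (pt_mor e1).

End PointSimplex.

Section Transition.
Variables (R : realType) (X : diffType R) (G : diffGroupType R) (C : cgf X).
Variable g : cocycle G C.

Definition trans (x : X) (P0 P1 : C) (r0 : pdom P0) (r1 : pdom P1)
    (e0 : P0 r0 = x) (e1 : P1 r1 = x) : G :=
  g (pt_simplex e0 e1) (pt0 R).

(** The 2-simplex is the one with all plots equal to the point [x]. *)
Lemma transM (x : X) (P0 P1 P2 : C) (r0 : pdom P0) (r1 : pdom P1)
    (r2 : pdom P2) (e0 : P0 r0 = x) (e1 : P1 r1 = x) (e2 : P2 r2 = x) :
  trans e0 e1 * trans e1 e2 = trans e0 e2.
Proof.
pose i := @PlotMor R X (pt_plot x) (pt_plot x) id (domain_smooth_id _) (fun=> erefl).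
pose s := @Simplex2 R X C P0 P1 P2 (pt_plot x) (pt_plot x) (pt_plot x)
  (pt_mor e0) (pt_mor e1) (pt_mor e0) (pt_mor e2) (pt_mor e1) (pt_mor e2)
  (pt_plot x) i i i (fun=> erefl) (fun=> erefl) (fun=> erefl).
exact: (@cocycleP _ _ _ _ g s (pt0 R)).
Qed.

Lemma trans1 (x : X) (P : C) (r : pdom P) (e e' : P r = x) : trans e e' = 1.
Proof.
rewrite (Prop_irrelevance e' e).
by apply: (mulgI (trans e e)); rewrite transM mulg1.
Qed.

(** In the 2-simplex spanned by [s], the point simplex at [q] and the degenerate
point simplex on the second vertex, the last one contributes [1] by [trans1].
Thus the cocycle does not see the plot in the middle of [s]. *)
Lemma cocycle_trans (s : simplex1 C) (q : pdom (s1Q s)) (x : X)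
    (e0 : s1P0 s (s1F1 s q) = x) (e1 : s1P1 s (s1F0 s q) = x) :
  g s q = trans e0 e1.
Proof.
case: s q e0 e1 => P0 P1 Q F1 F0 /= q e0 e1.
have qx : Q q = x by rewrite -e0 mfunE.
(* [Q] is the point [x], sent to [q] in the middle plot of the first face. *)
pose i := @PlotMor R X (pt_plot x) (pt_plot x) id (domain_smooth_id _) (fun=> erefl).
pose t := @Simplex2 R X C P0 P1 P1 Q (pt_plot x) (pt_plot x)
  F1 F0 (pt_mor e0) (pt_mor e1) (pt_mor e1) (pt_mor e1)
  (pt_plot x) i i (pt_mor qx) (fun=> erefl) (fun=> erefl) (fun=> erefl).
have : g (face2 t) q * trans e1 e1 = trans e0 e1.
  exact: (@cocycleP _ _ _ _ g t (pt0 R)).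
by rewrite trans1 mulg1.
Qed.

Lemma trans_plot n (V : domain R n) (x : V -> X) (P0 P1 : C)
    (b0 : V -> pdom P0) (b1 : V -> pdom P1)
    (e0 : forall v, P0 (b0 v) = x v) (e1 : forall v, P1 (b1 v) = x v) :
  domain_smooth b0 -> domain_smooth b1 ->
  is_plot (fun v => trans (e0 v) (e1 v)).
Proof.
move=> b0s b1s.
have xp : is_plot x.
  have -> : x = P0 \o b0 by apply/funext => v; rewrite /= e0.
  exact: (plot_comp (pfunP P0) b0s).
pose s := @Simplex1 R X C P0 P1 (Plot xp) (@PlotMor R X (Plot xp) P0 b0 b0s e0)
  (@PlotMor R X (Plot xp) P1 b1 b1s e1).
have -> : (fun v => trans (e0 v) (e1 v)) = g s.
  by apply/funext => v; rewrite (@cocycle_trans s v _ (e0 v) (e1 v)).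
exact/plot_smooth/(cochain1_smooth g s).
Qed.

(** A point of the bundle is described by its coordinates in all charts at once.
Compared with gluing the products [pdom P * G] along the transition elements,
this makes the coordinates functions on the total space by construction. *)
Record total := Total {
  tpt : X;
  tcoord : forall (P : C) (r : pdom P), P r = tpt -> G;
  tcoordP : forall (P0 P1 : C) (r0 : pdom P0) (r1 : pdom P1)
      (e0 : P0 r0 = tpt) (e1 : P1 r1 = tpt),
    tcoord e0 = trans e0 e1 * tcoord e1 }.

(** The compatibility condition determines all coordinates from a single one. *)
Lemma total_eq (a b : total) (P : C) (r : pdom P) (ea : P r = tpt a)
    (eb : P r = tpt b) : tcoord ea = tcoord eb -> a = b.
Proof.
case: a b ea eb => x a aP [y b bP] /= ea eb; have xy : x = y by rewrite -ea.
case: y / xy b bP eb => b bP eb; rewrite (Prop_irrelevance eb ea) => ab.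
have {}ab : a = b.
  apply: functional_extensionality_dep => P'.
  apply: functional_extensionality_dep => r'; apply/funext => e.
  by rewrite (aP _ _ _ _ e ea) (bP _ _ _ _ e ea) ab.
by subst b; congr Total; exact: Prop_irrelevance.
Qed.

(** The coarsest diffeology for which the projection and the coordinates are
smooth. A coordinate is only defined over the range of a chart, so its
smoothness is tested after a reparametrization [F] that comes with a lift [b]
to the chart. *)
Definition total_plot n (U : domain R n) (S : U -> total) : Prop :=
  is_plot (tpt \o S) /\
  forall (P : C) m (V : domain R m) (F : V -> U) (b : V -> pdom P)
    (e : forall v, P (b v) = tpt (S (F v))),
    domain_smooth F -> domain_smooth b -> is_plot (fun v => tcoord (e v)).

Fact total_plot_cover (a : total) :
  exists n (U : domain R n) (S : U -> total) (u : U), total_plot S /\ S u = a.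
Proof.
exists 0%N, (pt_domain R), (fun=> a), (pt0 R); split=> //; split.
  exact: plot_cst.
move=> P m V F b e Fs bs; have [P1 [r1 e1]] := cgf_cover C (tpt a).
(* Along a constant plot a coordinate varies only by the transition from the
   moving lift [b] to a fixed one [r1]. *)
have -> : (fun v => tcoord (e v)) = (fun v => trans (e v) e1 * tcoord e1).
  by apply/funext => v; exact: tcoordP.
apply/plot_smooth/smooth_mulg; last exact: smooth_cst.
apply: smooth_plot; apply: trans_plot => //.
exact: domain_smooth_cst.
Qed.

Fact total_plot_comp n m (U : domain R n) (V : domain R m)
    (S : U -> total) (F : V -> U) :
  total_plot S -> domain_smooth F -> total_plot (S \o F).
Proof.
move=> [S1 S2] Fs; split; first exact: (plot_comp S1 Fs).
move=> P k W F' b e F's bs.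
exact: (S2 P k W (F \o F') b e (domain_smooth_comp Fs F's) bs).
Qed.

Fact total_plot_sup n I (V : I -> domain R n) (Q : forall i, V i -> total)
    (U : domain R n) (S : U -> total) :
  (forall i, total_plot (Q i)) -> is_supremum Q S -> total_plot S.
Proof.
move=> Qp Ssup; split.
  apply: (plot_sup (Q := fun i => tpt \o Q i)) => [i|]; first by case: (Qp i).
  by case: Ssup => UV SQ; split=> // i v u uv /=; rewrite (SQ i v).
move=> P m W F b e Fs bs; apply: plot_local.
apply: locally_impl (locally_comp Fs (sup_locally Ssup)).
move=> W' k ki [V' [j [F' [[i [l [li SQ]]] ji F's FF']]]].
have SE w : S (F (k w)) = Q i (l (F' w)) by rewrite FF' SQ.
have e' w : P (b (k w)) = tpt (Q i (l (F' w))) by rewrite -SE.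
have -> : (fun v => tcoord (e v)) \o k = fun w => tcoord (e' w).
  apply/funext => w /=; move: (e (k w)) (e' w); rewrite SE => e1 e2.
  by rewrite (Prop_irrelevance e1 e2).
have [_ Qi] := Qp i; apply: (Qi P _ W' (l \o F') (b \o k) e').
- exact: domain_smooth_comp (inclusion_smooth li) F's.
- exact: domain_smooth_comp bs (inclusion_smooth ki).
Qed.

HB.instance Definition _ := isDiffeological.Build R total
  total_plot_cover total_plot_comp total_plot_sup.

Lemma tpt_smooth : smooth tpt.
Proof. by move=> n U S []. Qed.

Fact total_chartP (P : C) (x : (pdom P * G)%type) (P0 P1 : C) (r0 : pdom P0)
    (r1 : pdom P1) (e0 : P0 r0 = P x.1) (e1 : P1 r1 = P x.1) :
  trans e0 (erefl (P x.1)) * x.2 = trans e0 e1 * (trans e1 erefl * x.2).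
Proof. by rewrite mulgA transM. Qed.

Definition total_chart (P : C) (x : (pdom P * G)%type) : total :=
  @Total (P x.1) (fun P0 r0 e0 => trans e0 erefl * x.2) (@total_chartP P x).

Lemma total_chart_coord (P : C) (r : pdom P) (h : G) (e : P r = P r) :
  tcoord (t := total_chart (r, h)) e = h.
Proof. by rewrite /= trans1 mul1g. Qed.

Lemma total_chartK (a : total) (P : C) (r : pdom P) (e : P r = tpt a) :
  total_chart (r, tcoord e) = a.
Proof. exact: (total_eq (total_chart_coord _ erefl)). Qed.

(** The pullback property is immediate from the choice of the diffeology: the
second component of a map into [total] is its coordinate along the given
lift. *)
Lemma total_atlas : atlas tpt total_chart.
Proof.
move=> P; apply: triv_intro => [n U S [S1 S2]|//|r h h' hh'|Z b c bs cs bc].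
- split; first exact: (plot_comp (pfunP P) S1).
  move=> P' m V F b e Fs bs; apply: plot_smooth; apply: smooth_mulg.
    apply: smooth_plot; apply: trans_plot => //.
    exact: (domain_smooth_comp S1 Fs).
  exact: (smooth_comp (smooth_domain Fs) (smooth_plot S2)).
- have coord_eq a b (ea : P r = tpt a) (eb : P r = tpt b) :
      a = b -> tcoord ea = tcoord eb.
    by move=> ab; subst b; rewrite (Prop_irrelevance eb ea).
  have /= := coord_eq (total_chart (r, h)) (total_chart (r, h')) erefl erefl hh'.
  by rewrite trans1 !mul1g.
- exists (fun z => tcoord (bc z)) => [n U S Sp|z]; last exact: total_chartK.
  have [_ cS] := cs _ _ _ Sp.
  exact: (cS P n U id (b \o S) (fun u => bc (S u)) (domain_smooth_id U) (bs _ _ _ Sp)).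
Qed.

Lemma total_gauge (s : simplex1 C) (r : pdom (s1Q s)) (t : G) :
  total_chart (s1F0 s r, t) =
  total_chart (s1F1 s r, left_translation G (g s r) t).
Proof.
have e0 : s1P0 s (s1F1 s r) = s1P1 s (s1F0 s r) by rewrite !mfunE.
apply: (@total_eq (total_chart (s1F0 s r, t))
  (total_chart (s1F1 s r, left_translation G (g s r) t)) _ _ e0 erefl).
by rewrite total_chart_coord /= (cocycle_trans e0 erefl).
Qed.

Definition cocycle_bundle : gauge_bundle X (left_translation G) :=
  GaugeBundle tpt_smooth (GaugeData (fun P => (total_atlas P).1)
    (fun P => (total_atlas P).2) (cochain1_smooth g) total_gauge).

End Transition.

(** * Equivariant charts and principal bundles *)

Lemma subset_val_inj (R : realType) (X : diffType R) (A : set X) :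
  injective (@subset_val R X A).
Proof. exact: val_inj. Qed.

Definition to_subset (R : realType) (X : diffType R) (A : set X) (x : X)
  (Ax : A x) : subset_space A := exist _ x (mem_set Ax).

Section Equivariant.
Variables (R : realType) (X : diffType R) (G : diffGroupType R).
Variables (E : diffType R) (proj : E -> X) (alpha : smooth_action G E).

Definition equivariant n (U : domain R n) (psi : (U * G)%type -> E) : Prop :=
  forall k r h, alpha k (psi (r, h)) = psi (r, h * k^-1).

Definition locally_charted (P : plot X) : Prop :=
  locally (fun V (j : V -> pdom P) => exists psi : (V * G)%type -> E,
    trivializing proj (P \o j) psi /\ equivariant psi).

Hypothesis alpha_proj : forall g e, proj (alpha g e) = proj e.
Variable P : plot X.

Lemma pull_spaceP (y : pull_space proj P) :
  P (subset_val y).1 = proj (subset_val y).2.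
Proof. exact: (set_mem (valP y)). Qed.

(** Forgetting the first component of a local trivialization of the pullback
bundle yields a chart, and nothing is lost because that component is determined
by the base point. Together with [charted_locally_trivial] this eliminates
pullback bundles from the discussion. *)
Lemma locally_trivial_charted :
  locally_trivial_principal (@pull_proj R X E proj P) (pull_act (P := P) alpha_proj) ->
  locally_charted P.
Proof.
move=> [I [V [Vc Vchi]]] u; have /Vc [i Vu] := pvalP u.
have VU (v : V i) : dset (pdom P) (pval v) by apply/Vc; exists i; exact: pvalP.
exists (V i), (fun v => to_pt (VU v)); split=> //.
  by exists (to_pt Vu); exact: pval_inj.
have [chi [chi1 chi2]] := Vchi i.
pose Y := pull_space proj P.
pose A := [set y : Y | dset (V i) (pval (pull_proj y))].
have vals : smooth (fun y : subset_space A => subset_val (subset_val y)).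
  by move=> n W S Ss.
have chi_fst x : (subset_val (subset_val (chi x))).1 = to_pt (VU x.1).
  by apply: pval_inj; case: x => v h; exact: chi1.
exists (fun x => (subset_val (subset_val (chi x))).2); split; last first.
  by move=> k v h; rewrite [in RHS]chi2.
apply: triv_intro => [|x|v h h'|Z b c bs cs bc].
- exact: (smooth_comp (smooth_comp (dfun_smooth chi) vals) (@smooth_snd _ _ _)).
- by rewrite -pull_spaceP chi_fst.
- move=> hh'; have : chi (v, h) = chi (v, h').
    apply: subset_val_inj; apply: subset_val_inj.
    by rewrite [LHS]surjective_pairing hh' [RHS]surjective_pairing !chi_fst.
  by move=> /(congr1 (dinv chi)); rewrite !dfunK => -[].
- pose y z : Y := to_subset (A := pull_set (P := P) proj) (x := (to_pt (VU (b z)), c z)) (bc z).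
  have Ay z : A (y z) by exact: pvalP (b z).
  pose y' z : subset_space A := to_subset (Ay z).
  have y's : smooth y'.
    move=> n W S Ss; split; last exact: cs.
    have VUs : domain_smooth (fun v => to_pt (VU v)) by exact: inclusion_smooth.
    exact: (domain_smooth_comp VUs (bs _ _ _ Ss)).
  exists (fun z => (dinv chi (y' z)).2) => [|z].
    exact: (smooth_comp (smooth_comp y's (dinv_smooth chi)) (@smooth_snd _ _ _)).
  have chiy : chi (dinv chi (y' z)) = y' z by exact: dinvK.
  have -> : b z = (dinv chi (y' z)).1.
    apply: pval_inj; have := congr1 (@pval _ _ _) (chi_fst (dinv chi (y' z))).
    by rewrite chiy.
  by rewrite -surjective_pairing chiy.
Qed.

Lemma charted_locally_trivial :
  locally_charted P ->
  locally_trivial_principal (@pull_proj R X E proj P) (pull_act (P := P) alpha_proj).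
Proof.
move=> /locally_cover [V [j [Vc ji jpsi]]]; exists (pdom P), V; split=> // i.
have [psi [psiP psiG]] := jpsi i.
pose Y := pull_space proj P.
pose A := [set y : Y | dset (V i) (pval (pull_proj y))].
pose b (y : subset_space A) : V i := to_pt (set_mem (valP y)).
pose c (y : subset_space A) : E := (subset_val (subset_val y)).2.
have jb y : j i (b y) = (subset_val (subset_val y)).1.
  by apply: pval_inj; rewrite ji.
have bs : smooth b.
  move=> n W S [[s [cs sE]] _]; exists s; split=> // w; exact: sE.
have cs : smooth c by move=> n W S [].
have [|h hs hE] := triv_coord psiP bs cs.
  by move=> y; rewrite /= jb pull_spaceP.
have fP x : pull_set (P := P) proj (j i x.1, psi x) by rewrite /pull_set /= (triv_proj psiP).
have fA x : A (to_subset (fP x)) by rewrite /A /= /pull_proj /= ji; exact: pvalP.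
pose f x : subset_space A := to_subset (fA x).
have fs : smooth f.
  move=> n W S [S1 S2]; split; last exact: (triv_smooth psiP).
  exact: (domain_smooth_comp (inclusion_smooth (ji i)) S1).
have fE x : subset_val (subset_val (f x)) = (j i x.1, psi x) by [].
have bf x : b (f x) = x.1 by apply: pval_inj; exact: (ji i x.1).
have fK : cancel f (fun y => (b y, h y)).
  move=> [v k]; rewrite bf; congr pair; apply: (triv_inj psiP (r := v)).
  by have := hE (f (v, k)); rewrite bf.
have hK : cancel (fun y => (b y, h y)) f.
  move=> y; apply: subset_val_inj; apply: subset_val_inj.
  by rewrite fE hE jb /c -surjective_pairing.
exists (Diffeo fs (smooth_pair bs hs) fK hK); split=> [v k|k v g].
  exact: (ji i v).
by apply: subset_val_inj; rewrite fE -psiG.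
Qed.

End Equivariant.

Arguments locally_charted {R X G E} proj alpha P.

(** * The natural action on a bundle with gauge group *)

Section NaturalAction.
Variables (R : realType) (X : diffType R) (G : diffGroupType R).
Variables (E : diffType R) (proj : E -> X) (projs : smooth proj).
Variable D : gauge_data (left_translation G) proj.

Lemma gauge_atlas : atlas proj (chart D).
Proof. by move=> P; split; [exact: chart_smooth|exact: chart_pullback]. Qed.

(** The gauge relation at a point simplex compares any two charts at points over
the same [x]. *)
Lemma gauge_pt (x : X) (P0 P1 : gfam D) (r0 : pdom P0) (r1 : pdom P1)
    (e0 : P0 r0 = x) (e1 : P1 r1 = x) t :
  chart D P1 (r1, t) =
  chart D P0 (r0, gauge D (pt_simplex e0 e1) (pt0 R) * t).
Proof. exact: (@gaugeP _ _ _ _ _ _ _ D (pt_simplex e0 e1) (pt0 R) t). Qed.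

(** Changes of charts are left translations, hence commute with right ones. *)
Lemma chart_mulr (P0 P1 : gfam D) (r0 : pdom P0) (r1 : pdom P1) h0 h1 k :
  chart D P0 (r0, h0) = chart D P1 (r1, h1) ->
  chart D P0 (r0, h0 * k) = chart D P1 (r1, h1 * k).
Proof.
move=> h01; have e1 : P1 r1 = P0 r0.
  by rewrite -(triv_proj (gauge_atlas P1) (r1, h1)) -h01 (triv_proj (gauge_atlas P0)).
move: h01; rewrite !(gauge_pt erefl e1) mulgA => /(triv_inj (gauge_atlas P0)).
by move=> <-.
Qed.

Lemma natural_action_exists : exists alpha : smooth_action G E, natural_action D alpha.
Proof.
have /choice [a aE] : forall k : G, exists f : E -> E,
    forall P x, f (chart D P x) = chart D P (x.1, x.2 * k^-1).
  move=> k; apply: (atlas_glue gauge_atlas) => P P' [r h] [r' h'].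
  exact: chart_mulr.
have as_ : smooth (fun x : (G * E)%type => a x.1 x.2).
  apply: (atlas_smooth gauge_atlas) => // P /=.
  have -> : (fun x : (G * (pdom P * G))%type => a x.1 (chart D P x.2)) =
      chart D P \o (fun x => (x.2.1, x.2.2 * x.1^-1)).
    by apply/funext => x; rewrite /= aE.
  apply: (smooth_comp _ (chart_smooth D P)).
  have snds := @smooth_snd R G (pdom P * G)%type.
  apply: smooth_pair; first exact: (smooth_comp snds (@smooth_fst _ _ _)).
  apply: smooth_mulg; first exact: (smooth_comp snds (@smooth_snd _ _ _)).
  by apply: smooth_invg; exact: smooth_fst.
have aM g h e : a (g * h) e = a g (a h e).
  have [P [r [t <-]]] := atlas_cover gauge_atlas e.
  by rewrite !aE /= invgM mulgA.
have a1 e : a 1 e = e.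
  have [P [r [t <-]]] := atlas_cover gauge_atlas e.
  by rewrite !aE /= invg1 mulg1.
have ags g : smooth (a g).
  apply: (smooth_comp (f := fun e => (g, e)) _ as_).
  by apply: smooth_pair; [exact: smooth_cst|exact: smooth_id].
have aK g : cancel (a g) (a g^-1) by move=> e; rewrite -aM mulVg a1.
have aVK g : cancel (a g^-1) (a g) by move=> e; rewrite -aM mulgV a1.
pose phi g : Diff E := Diffeo (ags g) (ags g^-1) (aK g) (aVK g).
have phis : smooth phi.
  move=> n U S Ss; split.
    apply: (smooth_comp (f := fun x : (U * E)%type => (S x.1, x.2)) _ as_).
    apply: smooth_pair (@smooth_snd _ _ _).
    exact: (smooth_comp (@smooth_fst _ _ _) (smooth_plot Ss)).
  apply: (smooth_comp (f := fun x : (U * E)%type => ((S x.1)^-1, x.2)) _ as_).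
  apply: smooth_pair (@smooth_snd _ _ _); apply: smooth_invg.
  exact: (smooth_comp (@smooth_fst _ _ _) (smooth_plot Ss)).
by exists (SmoothAction phis aM) => P r h k; exact: aE.
Qed.

Lemma natural_action_principal (alpha : smooth_action G E) :
  natural_action D alpha -> is_principal alpha proj.
Proof.
move=> alphaE.
have inv g e : proj (alpha g e) = proj e.
  have [P [r [h <-]]] := atlas_cover gauge_atlas e.
  by rewrite alphaE !(triv_proj (gauge_atlas P)).
apply: (@Build_is_principal _ _ _ _ _ _ projs _ inv) => [x|P].
  have [P [r <-]] := cgf_cover (gfam D) x; exists (chart D P (r, 1)).
  exact: (triv_proj (gauge_atlas P)).
apply: charted_locally_trivial.
apply: locally_impl (cgf_local (gfam D) (pfunP P)) => V j ji [P' [F [Fs PF]]].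
exists (fun x => chart D P' (F x.1, x.2)); split; last first.
  by move=> k r h; exact: alphaE.
have -> : P \o j = P' \o F by exact/funext.
exact: triv_comp Fs (gauge_atlas P').
Qed.

End NaturalAction.

(** The cocycle relation expresses that the two ways of changing from the third
chart to the first agree; left translation is faithful. *)
Lemma gauge_cocycle (R : realType) (X : diffType R) (G : diffGroupType R)
    (B : gauge_bundle X (left_translation G)) :
  exists g : cocycle G (gfam B), forall s r, g s r = gauge B s r.
Proof.
have gE (s : simplex1 (gfam B)) r t : chart B (s1P1 s) (s1F0 s r, t) =
    chart B (s1P0 s) (s1F1 s r, gauge B s r * t) by exact: gaugeP.
suff gP : is_cocycle (Cochain1 (gauge_smooth B)) by exists (Cocycle gP).
move=> s r; suff : chart B (s2P0 s) (s2F12 s (s2F1 s r),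
      gauge B (face2 s) (s2F2 s r) * gauge B (face0 s) (s2F0 s r)) =
    chart B (s2P0 s) (s2F12 s (s2F1 s r), gauge B (face1 s) (s2F1 s r)).
  exact: (triv_inj (gauge_atlas (s2P0 s))).
rewrite -[gauge B (face0 s) _]mulg1 -[in RHS](mulg1 (gauge B _ _)).
rewrite -(gE (face1 s)) {1}s2E12 -(gE (face2 s)) /= -s2E02 -(gE (face0 s)) /=.
by rewrite s2E01.
Qed.

(** * Principal bundles are bundles with gauge group *)

(** The covering generating family consists of all plots with a global
equivariant chart. A gauge transformation is the coordinate, in one chart, of
the unit section of the other, and equivariance extends the relation from the
unit to all of [G]. *)
Lemma principal_gauge_data (R : realType) (X : diffType R) (G : diffGroupType R)
    (E : diffType R) (alpha : smooth_action G E) (proj : E -> X) :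
  is_principal alpha proj ->
  exists D : gauge_data (left_translation G) proj, natural_action D alpha.
Proof.
move=> prin.
pose K : set (plot X) := [set P | exists psi : (pdom P * G)%type -> E,
  trivializing proj P psi /\ equivariant alpha psi].
have Kgen : covering_generating K.
  apply: cgf_intro => P.
  apply: locally_impl (locally_trivial_charted (principal_triv prin P)).
  move=> V j ji [psi psiP].
  exists (Plot (plot_comp (pfunP P) (inclusion_smooth ji))); split.
    by exists psi.
  by exists id; [exact: domain_smooth_id|].
pose C := Cgf Kgen.
pose psi (P : C) := sval (cid (set_mem (valP P))).
have psiP (P : C) : trivializing proj P (psi P) := (svalP (cid (set_mem (valP P)))).1.
have psiG (P : C) : equivariant alpha (psi P) := (svalP (cid (set_mem (valP P)))).2.
have gaugeE (s : simplex1 C) : exists g : pdom (s1Q s) -> G, smooth g /\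
    forall r t, psi (s1P1 s) (s1F0 s r, t) =
      psi (s1P0 s) (s1F1 s r, left_translation G (g r) t).
  have F0s := @plot_mor_smooth _ _ _ _ (s1F0 s).
  have cs : smooth (fun r => psi (s1P1 s) (s1F0 s r, 1)).
    apply: (smooth_comp (f := fun r => (s1F0 s r, 1)) _ (triv_smooth (psiP _))).
    by apply: smooth_pair; [exact: F0s|exact: smooth_cst].
  have [|g gs gE] := triv_coord (psiP (s1P0 s)) (@plot_mor_smooth _ _ _ _ (s1F1 s)) cs.
    by move=> r; rewrite (triv_proj (psiP _)) !mfunE.
  (* Acting by [t^-1] is right multiplication by [t] in the charts. *)
  exists g; split=> // r t /=; have := congr1 (alpha t^-1) (gE r).
  by rewrite !psiG invgK mul1g.
exists (GaugeData (fun P => (psiP P).1) (fun P => (psiP P).2)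
  (fun s => (svalP (cid (gaugeE s))).1) (fun s => (svalP (cid (gaugeE s))).2)).
by move=> P r h k; exact: psiG.
Qed.

(** * Isomorphisms *)

Lemma locally_trans (R : realType) n (U : domain R n)
    (Phi : forall V : domain R n, (V -> U) -> Prop) :
  locally (fun V (j : V -> U) => locally (fun W (k : W -> V) => Phi W (j \o k))) ->
  locally Phi.
Proof.
move=> Pl u; have [V [j [ji [v <-] Pj]]] := Pl u.
have [W [k [ki [w <-] Pk]]] := Pj v; exists W, (j \o k); split=> //.
  by move=> x; rewrite /= ji.
by exists w.
Qed.

(** The plots that factor through a member of each family. *)
Lemma common_refinement (R : realType) (X : diffType R) (C C' : cgf X) :
  exists D : cgf X, inhabited (refinement C D) /\ inhabited (refinement C' D).
Proof.
pose K (C0 : cgf X) : set (plot X) := [set Q | inhabited {P : C0 & plot_mor Q P}].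
have ref (D C0 : cgf X) : (forall P : D, K C0 P) -> inhabited (refinement C0 D).
  move=> DK; pose F P := inhabited_witness (DK P).
  by split; exact: (Refinement (fun P => projT2 (F P))).
have KC : covering_generating (K C `&` K C').
  apply: cgf_intro => P; apply: locally_trans.
  apply: locally_impl (cgf_local C (pfunP P)) => V j ji [P0 [F [Fs PF]]].
  have Pj := plot_comp (pfunP P) (inclusion_smooth ji).
  apply: locally_impl (cgf_local C' Pj) => W k ki [P1 [F' [F's PF']]].
  have Pjk := plot_comp Pj (inclusion_smooth ki).
  exists (Plot Pjk); split; last by exists id; [exact: domain_smooth_id|].
  split; split.
    exists P0; apply: (@PlotMor _ _ (Plot Pjk) P0 (F \o k)) => [|w].
      exact: domain_smooth_comp Fs (inclusion_smooth ki).
    by rewrite /= -PF.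
  by exists P1; apply: (@PlotMor _ _ (Plot Pjk) P1 F') => // w; rewrite -PF'.
exists (Cgf KC); split; apply: ref => P; by have [] := set_mem (valP P).
Qed.

Section AtlasMap.
Variables (R : realType) (X : diffType R) (G : diffGroupType R) (D : cgf X).

(** Left multiplication by [h] in the charts is compatible with the changes of
charts of [psi] and [psi'] between points over the same point of [X]; it is the
pointwise form of the equivalence of cocycles by the 0-cochain [h]. *)
Definition intertwines (E E' : Type) (psi : forall P : D, (pdom P * G)%type -> E)
    (psi' : forall P : D, (pdom P * G)%type -> E') (h : forall P : D, pdom P -> G) :=
  forall (P0 P1 : D) (r0 : pdom P0) (r1 : pdom P1), P0 r0 = P1 r1 ->
  exists a a' : G,
    [/\ forall t, psi P1 (r1, t) = psi P0 (r0, a * t),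
        forall t, psi' P1 (r1, t) = psi' P0 (r0, a' * t) &
        a' * h P1 r1 = h P0 r0 * a].

Lemma intertwines_inv (E E' : Type) (psi : forall P : D, (pdom P * G)%type -> E)
    (psi' : forall P : D, (pdom P * G)%type -> E') (h : forall P : D, pdom P -> G) :
  intertwines psi psi' h -> intertwines psi' psi (fun P r => (h P r)^-1).
Proof.
move=> psih P0 P1 r0 r1 /psih [a [a' [aE a'E ha]]]; exists a', a; split=> //.
by apply: (mulgI (h P0 r0)); rewrite mulgA -ha mulgK mulVKg.
Qed.

Lemma atlas_map (E E' : diffType R) (proj : E -> X) (proj' : E' -> X)
    (psi : forall P : D, (pdom P * G)%type -> E)
    (psi' : forall P : D, (pdom P * G)%type -> E') (h : forall P : D, pdom P -> G) :
  smooth proj -> atlas proj psi -> atlas proj' psi' -> (forall P, smooth (h P)) ->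
  intertwines psi psi' h ->
  exists2 f : E -> E', smooth f &
    forall P r t, f (psi P (r, t)) = psi' P (r, h P r * t).
Proof.
move=> projs psiP psi'P hs psih.
have [|f fE] := @atlas_glue _ _ _ _ _ _ _ psiP _
    (fun P x => psi' P (x.1, h P x.1 * x.2)).
  move=> P0 P1 [r0 t0] [r1 t1] /= e.
  have /psih [a [a' [aE a'E ha]]] : P0 r0 = P1 r1.
    by rewrite -(triv_proj (psiP P1) (r1, t1)) -e (triv_proj (psiP P0)).
  move: e; rewrite aE => /(triv_inj (psiP P0)) ->.
  by rewrite a'E !mulgA ha.
exists f => [|P r t]; last by rewrite fE.
have fs : smooth (fun x : (E * E)%type => f x.2).
  apply: (atlas_smooth psiP) => // P /=.
  have -> : (fun x : (E * (pdom P * G))%type => f (psi P x.2)) =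
      psi' P \o (fun x => (x.2.1, h P x.2.1 * x.2.2)).
    by apply/funext => x; rewrite /= fE.
  apply: (smooth_comp _ (triv_smooth (psi'P P))).
  have snds := @smooth_snd R E (pdom P * G)%type.
  have r_s := smooth_comp snds (@smooth_fst _ _ _).
  apply: smooth_pair; first exact: r_s.
  apply: smooth_mulg; last exact: (smooth_comp snds (@smooth_snd _ _ _)).
  exact: smooth_comp r_s (hs P).
by apply: (smooth_comp (f := fun e => (e, e)) _ fs); exact: smooth_pair.
Qed.

Lemma atlas_diffeo (E E' : diffType R) (proj : E -> X) (proj' : E' -> X)
    (psi : forall P : D, (pdom P * G)%type -> E)
    (psi' : forall P : D, (pdom P * G)%type -> E') (h : forall P : D, pdom P -> G) :
  smooth proj -> smooth proj' -> atlas proj psi -> atlas proj' psi' ->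
  (forall P, smooth (h P)) -> intertwines psi psi' h ->
  exists f : diffeo E E',
    forall P r t, f (psi P (r, t)) = psi' P (r, h P r * t).
Proof.
move=> projs proj's psiP psi'P hs psih.
have [f fs fE] := atlas_map projs psiP psi'P hs psih.
have [f' f's f'E] := atlas_map proj's psi'P psiP (fun P => smooth_invg (hs P))
  (intertwines_inv psih).
have fK : cancel f f'.
  by move=> e; have [P [r [t <-]]] := atlas_cover psiP e; rewrite fE f'E mulKg.
have f'K : cancel f' f.
  by move=> e; have [P [r [t <-]]] := atlas_cover psi'P e; rewrite f'E fE mulVKg.
by exists (Diffeo fs f's fK f'K).
Qed.

End AtlasMap.

Section GaugeIso.
Variables (R : realType) (X : diffType R) (G : diffGroupType R).
Implicit Types B : gauge_bundle X (left_translation G).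

Definition ref_chart B (D : cgf X) (rho : refinement (gfam B) D) (P : D)
  (x : (pdom P * G)%type) := chart B (rmap rho P) (rmor rho P x.1, x.2).

Lemma ref_chart_atlas B (D : cgf X) (rho : refinement (gfam B) D) :
  atlas (gproj B) (ref_chart rho).
Proof. exact: (atlas_ref rho (gauge_atlas (D := B))). Qed.

(** On point simplices, equivalence of the gauges says that left multiplication
by [h] in the charts is well defined on total spaces. *)
Lemma equiv_gauge_iso B B' (D : cgf X) (rho : refinement (gfam B) D)
    (rho' : refinement (gfam B') D) (h : cochain0 D G) :
  (forall (s : simplex1 D) (r : pdom (s1Q s)),
    gauge B' (simplex1_ref rho' s) r * h (s1P1 s) (s1F0 s r) =
    h (s1P0 s) (s1F1 s r) * gauge B (simplex1_ref rho s) r) ->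
  gauge_bundle_iso B B'.
Proof.
move=> hE; have [|f fE] := atlas_diffeo (@gproj_smooth _ _ _ _ _ B) (@gproj_smooth _ _ _ _ _ B')
  (ref_chart_atlas rho) (ref_chart_atlas rho') (cochain0_smooth h).
  move=> P0 P1 r0 r1 e; pose s := pt_simplex e (erefl (P1 r1)).
  exists (gauge B (simplex1_ref rho s) (pt0 R)), (gauge B' (simplex1_ref rho' s) (pt0 R)).
  split=> [t|t|]; last exact: (hE s (pt0 R)).
    exact: (@gaugeP _ _ _ _ _ _ _ B (simplex1_ref rho s) (pt0 R) t).
  exact: (@gaugeP _ _ _ _ _ _ _ B' (simplex1_ref rho' s) (pt0 R) t).
exists f, D, rho, rho'; split=> [e|P].
  have [P [r [t <-]]] := atlas_cover (ref_chart_atlas rho) e.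
  by rewrite fE (triv_proj (ref_chart_atlas rho P)) (triv_proj (ref_chart_atlas rho' P)).
by exists (h P); [exact: cochain0_smooth|exact: fE].
Qed.

(** Going from the chart of [B] at the second vertex to the chart of [B'] at the
first one, the isomorphism can be applied before or after the change of charts;
comparing the elements of [G] obtained gives the relation. *)
Lemma gauge_iso_equiv B B' :
  gauge_bundle_iso B B' ->
  exists (D : cgf X) (rho : refinement (gfam B) D) (rho' : refinement (gfam B') D)
    (h : cochain0 D G), forall (s : simplex1 D) (r : pdom (s1Q s)),
      gauge B' (simplex1_ref rho' s) r * h (s1P1 s) (s1F0 s r) =
      h (s1P0 s) (s1F1 s r) * gauge B (simplex1_ref rho s) r.
Proof.
move=> [f [D [rho [rho' [fp fh]]]]].
pose h P := sval (cid2 (fh P)).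
have hs P : smooth (h P) by rewrite /h; case: cid2.
have hE P r t : f (ref_chart rho (P := P) (r, t)) = ref_chart rho' (P := P) (r, h P r * t).
  by rewrite /h; case: cid2 => h' _ /=; exact.
exists D, rho, rho', (Cochain0 hs) => s r /=.
apply: (triv_inj (ref_chart_atlas rho' (s1P0 s)) (r := s1F1 s r)).
have gE := @gaugeP _ _ _ _ _ _ _ B (simplex1_ref rho s) r 1.
have := congr1 f gE; rewrite /= !mulg1.
have -> := hE (s1P1 s) (s1F0 s r) 1; have -> := hE (s1P0 s) (s1F1 s r).
move=> <-; rewrite mulg1.
exact/esym/(@gaugeP _ _ _ _ _ _ _ B' (simplex1_ref rho' s) r).
Qed.

(** In the charts the natural action is by right translations and an isomorphism
of gauge bundles by left ones, so they commute. Conversely an equivariant map is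
determined in the charts by its value [h] on the unit section, and is left
multiplication by [h]. *)
Lemma gauge_iso_principal B B' (alpha : smooth_action G (gtot B))
    (alpha' : smooth_action G (gtot B')) (prin : is_principal alpha (gproj B))
    (prin' : is_principal alpha' (gproj B')) :
  natural_action B alpha -> natural_action B' alpha' ->
  gauge_bundle_iso B B' <->
  principal_bundle_iso (PrincipalBundle prin) (PrincipalBundle prin').
Proof.
move=> nat nat'; split=> [[f [D [rho [rho' [fp fh]]]]]|[f [fG fp]]].
  exists f; split=> // k e.
  have [P [r [t <-]]] := atlas_cover (ref_chart_atlas rho) e.
  have [h _ hE] := fh P.
  rewrite /= /ref_chart nat /= !hE nat'.
  by rewrite /= mulgA.
have [D [[rho] [rho']]] := common_refinement (gfam B) (gfam B').
exists f, D, rho, rho'; split=> // P.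
have cs : smooth (fun r => f (ref_chart rho (P := P) (r, 1))).
  apply: (smooth_comp _ (dfun_smooth f)).
  apply: (smooth_comp (f := fun r => (r, 1)) _ (triv_smooth (ref_chart_atlas rho P))).
  by apply: smooth_pair; [exact: smooth_id|exact: smooth_cst].
have [|h hs hE] := triv_coord (ref_chart_atlas rho' P) (@smooth_id _ _) cs.
  by move=> r; rewrite [RHS]fp; exact/esym/(triv_proj (ref_chart_atlas rho P)).
(* [h] was read off at the unit; acting by [t^-1] moves the unit to [t]. *)
exists h => // r t; have := congr1 (alpha' t^-1) (hE r).
have := fG t^-1 (ref_chart rho (P := P) (r, 1)).
by rewrite /= => <-; rewrite /ref_chart nat nat' /= invgK mul1g.
Qed.

End GaugeIso.

(** * Classification *)

Section Classification.
Variables (R : realType) (X : diffType R) (G : diffGroupType R).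
Implicit Types (B : gauge_bundle X (left_translation G)) (C D : cgf X).

Lemma principal_iso_equivalence : Equivalence (@principal_bundle_iso R X G).
Proof.
split=> [B|B B' [f [fG fp]]|B1 B2 B3 [f [fG fp]] [f' [f'G f'p]]].
- by exists (Diffeo (@smooth_id _ _) (@smooth_id _ _) (frefl _) (frefl _)).
- exists (Diffeo (dinv_smooth f) (dfun_smooth f) (dinvK f) (dfunK f)).
  split=> [g e|e] /=; last by rewrite -fp dinvK.
  by rewrite -{1}(dinvK f e) -fG dfunK.
- exists (Diffeo (smooth_comp (dfun_smooth f) (dfun_smooth f'))
    (smooth_comp (dinv_smooth f') (dinv_smooth f))
    (can_comp (dfunK f') (dfunK f)) (can_comp (dinvK f) (dinvK f'))).
  by split=> [g e|e] /=; rewrite ?fG ?f'G ?f'p ?fp.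
Qed.

Definition natural_bundle B : principal_bundle X G :=
  PrincipalBundle (natural_action_principal (@gproj_smooth _ _ _ _ _ B)
    (svalP (cid (natural_action_exists (@gproj_smooth _ _ _ _ _ B) B)))).

Lemma natural_bundleP B : natural_action B (pact (natural_bundle B)).
Proof. exact: (svalP (cid (natural_action_exists _ B))). Qed.

Lemma gauge_iso_natural B B' : gauge_bundle_iso B B' <->
  principal_bundle_iso (natural_bundle B) (natural_bundle B').
Proof. by apply: gauge_iso_principal; exact: natural_bundleP. Qed.

(** Transitivity would be laborious with explicit refinements; it is inherited
from principal bundles. *)
Lemma gauge_iso_equivalence : Equivalence (@gauge_bundle_iso R X G _ (left_translation G)).
Proof.
have [pr ps pt] := principal_iso_equivalence.
split=> [B|B B'|B1 B2 B3]; rewrite !gauge_iso_natural; first exact: pr.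
  exact: ps.
exact: pt.
Qed.

Lemma natural_bundle_unique B (alpha : smooth_action G (gtot B))
    (prin : is_principal alpha (gproj B)) :
  natural_action B alpha ->
  principal_bundle_iso (natural_bundle B) (PrincipalBundle prin).
Proof.
move=> nat; apply/(gauge_iso_principal _ _ (@natural_bundleP B) nat).
by have [gr _ _] := gauge_iso_equivalence; exact: gr.
Qed.

Lemma natural_bundle_surj (Q : principal_bundle X G) :
  exists B, principal_bundle_iso (natural_bundle B) Q.
Proof.
case: Q => E alpha proj prin; have [D nat] := principal_gauge_data prin.
exists (GaugeBundle (principal_smooth prin) D).
exact: (@natural_bundle_unique (GaugeBundle (principal_smooth prin) D)).
Qed.

Lemma bund_prin_bij :
  exists pr : Bund X (left_translation G) -> Bund_Prin X G, bijective pr /\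
    forall B, pr (bund_class B) = bund_prin_class (natural_bundle B).
Proof.
apply: quotient_bij => [B B'|Q].
  rewrite gauge_iso_natural; exact: class_of_eq principal_iso_equivalence.
have [Q' ->] := class_of_surj Q; have [B BQ] := natural_bundle_surj Q'.
by exists B; apply/class_of_eq => //; exact: principal_iso_equivalence.
Qed.

Definition id_mor (P : plot X) : plot_mor P P :=
  PlotMor (domain_smooth_id (pdom P)) (fun=> erefl).

Definition id_ref C : refinement C C := Refinement (fun P : C => id_mor P).

Lemma id_mor_comp (P Q : plot X) (F : plot_mor Q P) :
  plot_mor_comp (id_mor P) F = F.
Proof. by case: F => F Fs FE; congr PlotMor; exact: Prop_irrelevance. Qed.

Definition cochain0_1 C : cochain0 C G :=
  Cochain0 (fun P => @smooth_cst R (pdom P) G 1).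

Lemma cocycle_equivalence C : Equivalence (@cocycle_equiv R X G C).
Proof.
split=> [g|g g' [h hE]|g1 g2 g3 [h hE] [h' h'E]].
- by exists (cochain0_1 C) => s r; rewrite mulg1 mul1g.
- exists (Cochain0 (fun P => smooth_invg (cochain0_smooth h P))) => s r /=.
  by apply: (mulgI (h (s1P0 s) (s1F1 s r))); rewrite mulgA -hE mulgK mulVKg.
- exists (Cochain0 (fun P => smooth_mulg (cochain0_smooth h' P) (cochain0_smooth h P))).
  by move=> s r /=; rewrite mulgA h'E -mulgA hE mulgA.
Qed.

Lemma cocycle_bundle_equiv C (g g' : cocycle G C) :
  cocycle_equiv g g' -> gauge_bundle_iso (cocycle_bundle g) (cocycle_bundle g').
Proof.
move=> [h hE]; apply: (@equiv_gauge_iso _ _ _ (cocycle_bundle g) (cocycle_bundle g')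
  C (id_ref C) (id_ref C) h) => s r.
exact: (hE (simplex1_ref (id_ref C) s) r).
Qed.

Lemma cocycle_bundle_ref C D (rho : refinement C D) (g : cocycle G C) :
  gauge_bundle_iso (cocycle_bundle (cocycle_ref rho g)) (cocycle_bundle g).
Proof.
apply: (@equiv_gauge_iso _ _ _ (cocycle_bundle (cocycle_ref rho g)) (cocycle_bundle g)
  D (id_ref D) rho (cochain0_1 D)) => -[P0 P1 Q F1 F0] r /=.
by rewrite mulg1 mul1g /simplex1_ref /= !id_mor_comp.
Qed.

(** A bundle is recovered from its gauge cocycle. *)
Lemma cocycle_bundle_gauge B (g : cocycle G (gfam B)) :
  (forall s r, g s r = gauge B s r) -> gauge_bundle_iso (cocycle_bundle g) B.
Proof.
move=> gB; apply: (@equiv_gauge_iso _ _ _ (cocycle_bundle g) B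
  (gfam B) (id_ref _) (id_ref _) (cochain0_1 _)) => s r /=.
by rewrite mulg1 mul1g -gB.
Qed.

Lemma cocycle_bundle_iso C C' (g : cocycle G C) (g' : cocycle G C') :
  gauge_bundle_iso (cocycle_bundle g) (cocycle_bundle g') ->
  exists D (rho : refinement C D) (rho' : refinement C' D),
    cocycle_equiv (cocycle_ref rho g) (cocycle_ref rho' g').
Proof.
move=> /gauge_iso_equiv [D [rho [rho' [h hE]]]]; exists D, rho, rho', h; exact: hE.
Qed.

Lemma bund_prin_class_eq B B' :
  bund_prin_class (natural_bundle B) = bund_prin_class (natural_bundle B') <->
  gauge_bundle_iso B B'.
Proof.
rewrite gauge_iso_natural; exact: class_of_eq principal_iso_equivalence.
Qed.

Lemma bund_class_eq B B' :
  bund_class B = bund_class B' <-> gauge_bundle_iso B B'.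
Proof. exact: class_of_eq gauge_iso_equivalence. Qed.

Lemma cech_H1_bij :
  exists cl : cech_H1 X G -> Bund X (left_translation G), bijective cl /\
    forall C (g : cocycle G C), cl (cech_class g) = bund_class (cocycle_bundle g).
Proof.
apply: (@colimit_bij R X (fun C => cocycle G C) (@cocycle_equiv R X G)
  (@cocycle_ref R X G) _ (fun C g => bund_class (cocycle_bundle g))).
- exact: cocycle_equivalence.
- by move=> C g g' /cocycle_bundle_equiv /bund_class_eq.
- by move=> C C' rho g; apply/bund_class_eq; exact: cocycle_bundle_ref.
- by move=> C C' g g' /bund_class_eq; exact: cocycle_bundle_iso.
- move=> b; have [B ->] := class_of_surj b; have [g gB] := gauge_cocycle B.
  by exists (gfam B), g; apply/bund_class_eq; exact: cocycle_bundle_gauge.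
Qed.

Section Abelian.
Hypothesis mulC : forall g h : G, g * h = h * g.

Lemma cocycle_delta1 C (c : cochain1 C G) :
  is_cocycle c <-> forall s r, delta1 c s r = 1.
Proof.
split=> cE s r; have /= := cE s r.
  by move=> cE'; rewrite /= mulC mulgA cE' mulgV.
rewrite mulC mulgA => cE'.
by rewrite -[LHS]mulg1 -(mulVg (c (face1 s) (s2F1 s r))) mulgA cE' mul1g.
Qed.

Definition cocycle_of_ab C (c : ab_cocycle G C) : cocycle G C :=
  Cocycle ((cocycle_delta1 c).2 (@ab_cocycleP _ _ _ _ c)).

Lemma div_eq_comm (x y u v : G) : x * y^-1 = u * v^-1 <-> x * u^-1 = v^-1 * y.
Proof.
split=> [xE|xE].
  have -> : x = u * v^-1 * y by rewrite -xE -mulgA mulVg mulg1.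
  by rewrite mulC -mulgA mulKg.
have -> : x = v^-1 * y * u by rewrite -xE -mulgA mulVg mulg1.
by rewrite mulC (mulC v^-1) -mulgA mulKg mulC.
Qed.

(** The sign convention of [delta0] is opposite to that of [cocycle_equiv], so
the 0-cochains correspond by inversion. *)
Lemma cohomologous_equiv C (c c' : ab_cocycle G C) :
  cohomologous c c' <-> cocycle_equiv (cocycle_of_ab c) (cocycle_of_ab c').
Proof.
split=> [[b bE]|[h hE]].
  exists (Cochain0 (fun P => smooth_invg (cochain0_smooth b P))) => s r /=.
  exact/div_eq_comm/bE.
exists (Cochain0 (fun P => smooth_invg (cochain0_smooth h P))) => s r /=.
by apply/div_eq_comm; rewrite !invgK; exact: hE.
Qed.

Lemma ab_cech_H1_bij :
  exists f : ab_cech_H1 X G -> Bund_Prin X G, bijective f /\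
    forall C (c : ab_cocycle G C), f (ab_cech_class c) =
      bund_prin_class (natural_bundle (cocycle_bundle (cocycle_of_ab c))).
Proof.
apply: (@colimit_bij R X (fun C => ab_cocycle G C) (@cohomologous R X G)
  (@ab_cocycle_ref R X G) _
  (fun C c => bund_prin_class (natural_bundle (cocycle_bundle (cocycle_of_ab c))))).
- move=> C; have [er es et] := cocycle_equivalence C.
  split=> [c|c c'|c1 c2 c3]; rewrite !cohomologous_equiv; first exact: er.
    exact: es.
  exact: et.
- move=> C c c' /cohomologous_equiv /cocycle_bundle_equiv cc'.
  exact/bund_prin_class_eq.
- move=> C C' rho c; apply/bund_prin_class_eq.
  have -> : cocycle_of_ab (ab_cocycle_ref rho c) = cocycle_ref rho (cocycle_of_ab c).
    by congr Cocycle; exact: Prop_irrelevance.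
  exact: cocycle_bundle_ref.
- move=> C C' c c' /bund_prin_class_eq /cocycle_bundle_iso [D [rho [rho' cc']]].
  by exists D, rho, rho'; apply/cohomologous_equiv.
- move=> Q; have [Q' ->] := class_of_surj Q; have [B BQ] := natural_bundle_surj Q'.
  have [g gB] := gauge_cocycle B.
  exists (gfam B), (AbCocycle ((cocycle_delta1 g).1 (@cocycleP _ _ _ _ g))).
  transitivity (bund_prin_class (natural_bundle B)).
    exact/bund_prin_class_eq/cocycle_bundle_gauge.
  by apply/class_of_eq => //; exact: principal_iso_equivalence.
Qed.

End Abelian.
End Classification.

Theorem proposition6p11 (R : realType) (X : diffType R) (G : diffGroupType R) :
  [/\ (* principal bundles are fiber bundles with gauge group G and fiber G *)
      forall B : principal_bundle X G,
        exists D : gauge_data (left_translation G) (pproj B),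
          natural_action D (pact B),
      (* and conversely *)
      forall B : gauge_bundle X (left_translation G),
        exists alpha : smooth_action G (gtot B),
          natural_action B alpha /\
          is_principal alpha (gproj B),
      (* H^1(X, G) ~ Bund_G(X, G) ~ Bund_Prin(X, G) *)
      exists (cl : cech_H1 X G -> Bund X (left_translation G))
             (pr : Bund X (left_translation G) -> Bund_Prin X G),
        [/\ bijective cl, bijective pr,
            forall (B : gauge_bundle X (left_translation G))
                   (g : cocycle G (gfam B)),
              (forall s r, g s r = gauge B s r) ->
              cl (cech_class g) = bund_class B &
            forall (B : gauge_bundle X (left_translation G))
                   (alpha : smooth_action G (gtot B))
                   (prin : is_principal alpha (gproj B)),
              natural_action B alpha ->
              pr (bund_class B) =
              bund_prin_class (PrincipalBundle prin)] &
      (* the abelian case *)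
      (forall g h : G, (g * h = h * g)%g) ->
      exists f : ab_cech_H1 X G -> Bund_Prin X G,
        bijective f /\
        (forall (B : gauge_bundle X (left_translation G))
                (g : ab_cocycle G (gfam B))
                (alpha : smooth_action G (gtot B))
                (prin : is_principal alpha (gproj B)),
           (forall s r, g s r = gauge B s r) -> natural_action B alpha ->
           f (ab_cech_class g) =
           bund_prin_class (PrincipalBundle prin))].
Proof.
have [cl [clB clE]] := cech_H1_bij X G; have [pr [prB prE]] := bund_prin_bij X G.
split.
- by move=> B; exact: principal_gauge_data (pprojP B).
- move=> B; have [alpha nat] := natural_action_exists (@gproj_smooth _ _ _ _ _ B) B.
  exists alpha; split=> //.
  exact: (natural_action_principal (@gproj_smooth _ _ _ _ _ B) nat).
- exists cl, pr; split=> // [B g gB|B alpha prin nat].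
    by rewrite clE; apply/bund_class_eq; exact: cocycle_bundle_gauge.
  rewrite prE; apply/class_of_eq; first exact: principal_iso_equivalence.
  exact: natural_bundle_unique.
- move=> mulC; have [f [fB fE]] := ab_cech_H1_bij X mulC; exists f; split=> //.
  move=> B g alpha prin gB nat; rewrite fE.
  transitivity (bund_prin_class (natural_bundle B)).
    exact/bund_prin_class_eq/cocycle_bundle_gauge.
  apply/class_of_eq; first exact: principal_iso_equivalence.
  exact: natural_bundle_unique.
Qed.
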